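(* Let $n\ge 3$ and let $T\colon M_n(\mathbb F)\to M_n(\mathbb F)$ be a real-linear map. The following are equivalent. (i) $T$ is bijective and $T(\mathcal U_n(\mathbb F))\subseteq \mathbb F\,\mathcal U_n(\mathbb F)$, i.e. $T$ maps every matrix in $\mathcal U_n(\mathbb F)$ to a scalar multiple of a matrix in $\mathcal U_n(\mathbb F)$. (ii) There are $U,V\in\mathcal U_n(\mathbb F)$ and $r>0$ such that $T$ has one of the four forms $X\mapsto rUXV$, $X\mapsto rUX^TV$, $X\mapsto rU\overline{X}V$, $X\mapsto rU\overline{X}^TV$ (for all $X\in M_n(\mathbb F)$). Moreover, if $\mathbb F=\mathbb C$ and $T$ is complex-linear, then only the first two forms occur.
   Context: $\mathbb F$ denotes either $\mathbb C$ or $\mathbb R$, and $M_n(\mathbb F)$ the $n\times n$ matrices over $\mathbb F$. For $A\in M_n(\mathbb F)$, $A^*$ is the conjugate transpose (the transpose if $\mathbb F=\mathbb R$), $A^T$ is the transpose and $\overline{A}$ the entrywise complex conjugate. $\mathcal U_n(\mathbb F)=\{A\in M_n(\mathbb F): A^*A=I_n\}$ (unitary matrices if $\mathbb F=\mathbb C$, orthogonal if $\mathbb F=\mathbb R$), and $\mathbb F\,\mathcal U_n(\mathbb F)=\{\gamma U:\gamma\in\mathbb F,\ U\in\mathcal U_n(\mathbb F)\}$. *)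

(* Defs.v *)
From HB Require Import structures.
From mathcomp Require Import all_boot all_order all_algebra.
From mathcomp Require Import all_classical all_reals.
From mathcomp.real_closed Require Import complex.

Set Implicit Arguments.
Unset Strict Implicit.
Unset Printing Implicit Defensive.

Import Order.TTheory GRing.Theory Num.Theory.
Local Open Scope ring_scope.
Local Open Scope complex_scope.

Definition conj_mx (R : realType) (m n : nat) (A : 'M[R[i]]_(m, n)) :
  'M[R[i]]_(m, n) := map_mx (@conjc R) A.

Definition orthogonal_mx (R : realType) (n : nat) (A : 'M[R]_n) : Prop :=
  A^T *m A = 1%:M.

Definition unitary_mx (R : realType) (n : nat) (A : 'M[R[i]]_n) : Prop :=
  (conj_mx A)^T *m A = 1%:M.

Definition real_linear_R (R : realType) (n : nat) (T : 'M[R]_n -> 'M[R]_n) :=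
  forall (a : R) (X Y : 'M[R]_n), T (a *: X + Y) = a *: T X + T Y.

Definition real_linear_C (R : realType) (n : nat)
  (T : 'M[R[i]]_n -> 'M[R[i]]_n) :=
  forall (a : R) (X Y : 'M[R[i]]_n), T (a%:C *: X + Y) = a%:C *: T X + T Y.

Definition complex_linear (R : realType) (n : nat)
  (T : 'M[R[i]]_n -> 'M[R[i]]_n) :=
  forall (a : R[i]) (X Y : 'M[R[i]]_n), T (a *: X + Y) = a *: T X + T Y.

Definition preserves_scaled_orth (R : realType) (n : nat)
  (T : 'M[R]_n -> 'M[R]_n) : Prop :=
  forall X, orthogonal_mx X ->
    exists (g : R) (U : 'M[R]_n), orthogonal_mx U /\ T X = g *: U.

Definition preserves_scaled_unitary (R : realType) (n : nat)
  (T : 'M[R[i]]_n -> 'M[R[i]]_n) : Prop :=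
  forall X, unitary_mx X ->
    exists (g : R[i]) (U : 'M[R[i]]_n), unitary_mx U /\ T X = g *: U.

(* standard forms, F = R (conjugation is the identity, so the four forms
   X, X^T, conj X, conj X^T reduce to the two forms X, X^T) *)
Definition std_form_R (R : realType) (n : nat) (T : 'M[R]_n -> 'M[R]_n) :=
  exists (U V : 'M[R]_n) (r : R),
    [/\ orthogonal_mx U, orthogonal_mx V, 0 < r &
      (forall X, T X = r *: (U *m X *m V)) \/
      (forall X, T X = r *: (U *m X^T *m V))].

Definition std_form_C (R : realType) (n : nat)
  (T : 'M[R[i]]_n -> 'M[R[i]]_n) :=
  exists (U V : 'M[R[i]]_n) (r : R),
    [/\ unitary_mx U, unitary_mx V, 0 < r &
      [\/ (forall X, T X = r%:C *: (U *m X *m V)),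
          (forall X, T X = r%:C *: (U *m X^T *m V)),
          (forall X, T X = r%:C *: (U *m conj_mx X *m V)) |
          (forall X, T X = r%:C *: (U *m (conj_mx X)^T *m V))]].

Definition std_form_C_lin (R : realType) (n : nat)
  (T : 'M[R[i]]_n -> 'M[R[i]]_n) :=
  exists (U V : 'M[R[i]]_n) (r : R),
    [/\ unitary_mx U, unitary_mx V, 0 < r &
      (forall X, T X = r%:C *: (U *m X *m V)) \/
      (forall X, T X = r%:C *: (U *m X^T *m V))].

(* Main.v *)
Require Import Defs.
From HB Require Import structures.
From mathcomp Require Import all_boot all_order all_algebra.
From mathcomp Require Import all_classical all_reals.
From mathcomp.real_closed Require Import complex.
From mathcomp Require Import ring zify.

Set Implicit Arguments.
Unset Strict Implicit.
Unset Printing Implicit Defensive.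

Import Order.TTheory GRing.Theory Num.Theory.
Local Open Scope ring_scope.

(** Let [^h] denote the conjugate transpose. Write [f(X) = T(X)^h T(X)] and [B]
    for its polarization. For [u] orthogonal to [u'] and [v] to [v'], a second
    difference of [f] over four unitary matrices shows that [B(u v^h, u' v'^h)]
    is scalar. If some [M = T(u v^h)] were invertible, then [M^h T(Y)] would be
    real scalar plus skew-Hermitian and commute with [M^h M] for all [Y]
    orthogonal to [u v^h]; a dimension count (here [n >= 3]) makes [M^h M]
    scalar, this spreads to all rank one matrices by perturbation, and then [f]
    is scalar everywhere, which contradicts surjectivity. So rank one matrices
    have singular images, and [B(u v^h, u' v'^h) = 0].

    Fix [w <> 0]. The vectors [T(u v^h) w] are then orthogonal whenever [u, u']
    and [v, v'] are. For [n >= 3] this forces the kernel of [X |-> T(X) w] to be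
    [{X | X y = 0}] for some [y], or [{X | y^h X = 0}] for some [y]; all [w] are
    of the same kind. In the first case, comparing [w = e_0] with [w = e_0 + c
    e_i] gives [T(X) e_i = psi(X z_i)] for one map [psi], which is linear or
    conjugate linear. Hence [T(X) = A X B] or [T(X) = A conj(X) B], and [A], [B]
    are multiples of unitary matrices since [A^h A] commutes with all unitary
    matrices. *)

(* The common setting for [F = R] and [F = C]: a field with an involution [cj]
   and real coordinates, of which [coord ord0] is the real part. *)
Record starField (R : rcfType) := StarField {
  carrier :> fieldType;
  inj : {rmorphism R -> carrier};
  cj : {rmorphism carrier -> carrier};
  dim : nat;
  coord : 'I_dim.+1 -> carrier -> R;
  vec : 'I_dim.+1 -> carrier;
  cjK : involutive cj;
  cj_inj : forall a, cj (inj a) = inj a;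
  coord_lin : forall k a x y, coord k (inj a * x + y) = a * coord k x + coord k y;
  coord_span : forall x, x = \sum_k inj (coord k x) * vec k;
  coord_sum : forall c k, coord k (\sum_l inj (c l) * vec l) = c k;
  re_cj : forall x, coord ord0 (cj x) = coord ord0 x;
  re_pos : forall x, x != 0 -> 0 < coord ord0 (cj x * x);
  self_adjoint : forall x, cj x = x -> x = inj (coord ord0 x);
  re_repr : forall f : carrier -> R, (forall a x y, f (inj a * x + y) = a * f x + f y) ->
    exists b, forall x, f x = coord ord0 (b * x);
  real_endo : forall f : carrier -> carrier, {morph f : x y / x + y} ->
    {morph f : x y / x * y} -> (forall a, f (inj a) = inj a) -> f =1 id \/ f =1 cj
}.

Arguments inj {R s}.
Arguments cj {R s}.
Arguments coord {R s}.
Arguments vec {R s}.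

(** * Coordinates, real part and norm of scalars *)

Section StarFieldTheory.
Variables (R : rcfType) (F : starField R).
Implicit Types (a b : R) (x y : F).

Definition re (x : F) : R := coord ord0 x.

Lemma coordD k x y : coord k (x + y) = coord k x + coord k y.
Proof. by rewrite -[x]mul1r -(rmorph1 inj) coord_lin mul1r rmorph1 mul1r. Qed.
Lemma coord0 k : coord k (0 : F) = 0.
Proof. by apply: (addrI (coord k 0)); rewrite -coordD !addr0. Qed.
Lemma coordZ k a x : coord k (inj a * x) = a * coord k x.
Proof. by rewrite -[inj a * x]addr0 coord_lin coord0 addr0. Qed.
Lemma reD x y : re (x + y) = re x + re y. Proof. exact: coordD. Qed.
Lemma re0 : re 0 = 0. Proof. exact: coord0. Qed.
Lemma reZ a x : re (inj a * x) = a * re x. Proof. exact: coordZ. Qed.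
Lemma reN x : re (- x) = - re x.
Proof. by apply/eqP; rewrite -addr_eq0 -reD addNr re0. Qed.
Lemma re_cjE x : re (cj x) = re x. Proof. exact: re_cj. Qed.

Lemma re_sum (I : Type) (r : seq I) (P : pred I) (f : I -> F) :
  re (\sum_(i <- r | P i) f i) = \sum_(i <- r | P i) re (f i).
Proof. by elim/big_rec2: _ => [|i a b _ <-]; rewrite ?re0 ?reD. Qed.

Lemma inj_eq0 a : (inj a == 0 :> F) = (a == 0). Proof. exact: fmorph_eq0. Qed.
Lemma inj_inj : injective (inj : R -> F). Proof. exact: fmorph_inj. Qed.

Lemma re_inj a : re (inj a) = a.
Proof. by apply: inj_inj; rewrite -self_adjoint // cj_inj. Qed.

Lemma coord_eq0 x : (forall k, coord k x = 0) -> x = 0.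
Proof.
by move=> h; rewrite (coord_span x) big1 // => k _; rewrite h rmorph0 mul0r.
Qed.

(** The choice [c = cj x] gives a squared norm. This turns real identities into identities in
    [F]. *)
Lemma re_eq0 x : (forall c, re (c * x) = 0) -> x = 0.
Proof.
move=> h; apply/eqP/negPn/negP => /re_pos; rewrite -/(re _) h ltxx //.
Qed.

Lemma normE x : cj x * x = inj (re (cj x * x)).
Proof. by apply: self_adjoint; rewrite rmorphM cjK mulrC. Qed.

Lemma norm_ge0 x : 0 <= re (cj x * x).
Proof. by have [->|/re_pos/ltW //] := eqVneq x 0; rewrite mulr0 re0. Qed.

Lemma norm_eq0 x : re (cj x * x) = 0 -> x = 0.
Proof. by move=> h; apply/eqP/negPn/negP => /re_pos; rewrite -/(re _) h ltxx. Qed.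

End StarFieldTheory.

(** * Conjugate transpose and unitary matrices *)

Section ConjTranspose.
Variables (R : rcfType) (F : starField R).

Definition ct (m n : nat) (A : 'M[F]_(m, n)) : 'M[F]_(n, m) := (map_mx cj A)^T.
Local Notation "A ^h" := (ct A) (at level 2, format "A ^h").

Lemma ctE m n (A : 'M[F]_(m, n)) i j : A^h i j = cj (A j i).
Proof. by rewrite !mxE. Qed.
Lemma ctK m n (A : 'M[F]_(m, n)) : A^h^h = A.
Proof. by apply/matrixP=> i j; rewrite !ctE cjK. Qed.
Lemma ctD m n (A B : 'M[F]_(m, n)) : (A + B)^h = A^h + B^h.
Proof. by rewrite /ct map_mxD linearD. Qed.
Lemma ctN m n (A : 'M[F]_(m, n)) : (- A)^h = - A^h.
Proof. by rewrite /ct map_mxN linearN. Qed.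
Lemma ctB m n (A B : 'M[F]_(m, n)) : (A - B)^h = A^h - B^h.
Proof. by rewrite ctD ctN. Qed.
Lemma ct0 m n : (0 : 'M[F]_(m, n))^h = 0.
Proof. by rewrite /ct map_mx0 linear0. Qed.
Lemma ctZ m n a (A : 'M[F]_(m, n)) : (a *: A)^h = cj a *: A^h.
Proof. by rewrite /ct map_mxZ linearZ. Qed.
Lemma ctZr m n (a : R) (A : 'M[F]_(m, n)) : (inj a *: A)^h = inj a *: A^h.
Proof. by rewrite ctZ cj_inj. Qed.
Lemma ctM m n p (A : 'M[F]_(m, n)) (B : 'M_(n, p)) : (A *m B)^h = B^h *m A^h.
Proof. by rewrite /ct map_mxM trmx_mul. Qed.
Lemma ct_scalar n a : (a%:M : 'M[F]_n)^h = (cj a)%:M.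
Proof. by rewrite /ct map_scalar_mx tr_scalar_mx. Qed.
Lemma ct1 n : (1%:M : 'M[F]_n)^h = 1%:M.
Proof. by rewrite ct_scalar rmorph1. Qed.
Lemma ct_delta m n (i : 'I_m) (j : 'I_n) : (delta_mx i j : 'M[F]_(m, n))^h = delta_mx j i.
Proof. by rewrite /ct map_delta_mx trmx_delta. Qed.
Lemma ct_eq0 m n (A : 'M[F]_(m, n)) : A^h = 0 -> A = 0.
Proof. by move=> h; rewrite -[A]ctK h ct0. Qed.

Definition dot n (x y : 'cV[F]_n) : F := (x^h *m y) 0 0.

Lemma dotE n (x y : 'cV[F]_n) : x^h *m y = (dot x y)%:M.
Proof. by rewrite [LHS]mx11_scalar. Qed.
Lemma dot_sum n (x y : 'cV[F]_n) : dot x y = \sum_i cj (x i 0) * y i 0.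
Proof. by rewrite /dot mxE; apply: eq_bigr => i _; rewrite ctE. Qed.
Lemma dotC n (x y : 'cV[F]_n) : dot y x = cj (dot x y).
Proof. by rewrite -ctE /dot ctM ctK. Qed.
Lemma dotDr n (x y z : 'cV[F]_n) : dot x (y + z) = dot x y + dot x z.
Proof. by rewrite /dot mulmxDr mxE. Qed.
Lemma dotZr n a (x y : 'cV[F]_n) : dot x (a *: y) = a * dot x y.
Proof. by rewrite /dot -scalemxAr mxE. Qed.
Lemma dotNr n (x y : 'cV[F]_n) : dot x (- y) = - dot x y.
Proof. by rewrite /dot mulmxN mxE. Qed.
Lemma dot0r n (x : 'cV[F]_n) : dot x 0 = 0.
Proof. by rewrite /dot mulmx0 mxE. Qed.
Lemma dotBr n (x y z : 'cV[F]_n) : dot x (y - z) = dot x y - dot x z.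
Proof. by rewrite dotDr dotNr. Qed.
Lemma dotDl n (x y z : 'cV[F]_n) : dot (x + y) z = dot x z + dot y z.
Proof. by rewrite /dot ctD mulmxDl mxE. Qed.
Lemma dotNl n (x y : 'cV[F]_n) : dot (- x) y = - dot x y.
Proof. by rewrite /dot ctN mulNmx mxE. Qed.
Lemma dotZl n a (x y : 'cV[F]_n) : dot (a *: x) y = cj a * dot x y.
Proof. by rewrite /dot ctZ -scalemxAl mxE. Qed.
Lemma dot0l n (x : 'cV[F]_n) : dot 0 x = 0.
Proof. by rewrite /dot ct0 mul0mx mxE. Qed.
Lemma dot_mull m n (A : 'M[F]_(m, n)) x y : dot (A *m x) y = dot x (A^h *m y).
Proof. by rewrite /dot ctM mulmxA. Qed.
Lemma dot_mulr m n (A : 'M[F]_(m, n)) x y : dot x (A *m y) = dot (A^h *m x) y.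
Proof. by rewrite dot_mull ctK. Qed.

Definition nrm n (x : 'cV[F]_n) : R := re (dot x x).

Lemma nrmE n (x : 'cV[F]_n) : dot x x = inj (nrm x).
Proof. by apply: self_adjoint; rewrite -dotC. Qed.
Lemma nrm_sum n (x : 'cV[F]_n) : nrm x = \sum_i re (cj (x i 0) * x i 0).
Proof. by rewrite /nrm dot_sum re_sum. Qed.
Lemma nrm_ge0 n (x : 'cV[F]_n) : 0 <= nrm x.
Proof. by rewrite nrm_sum sumr_ge0 // => i _; apply: norm_ge0. Qed.
Lemma nrm_eq0 n (x : 'cV[F]_n) : nrm x = 0 -> x = 0.
Proof.
rewrite nrm_sum => /eqP; rewrite psumr_eq0; last by move=> *; apply: norm_ge0.
move=> /allP h; apply/matrixP=> i j; rewrite ord1 mxE.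
by apply: norm_eq0; apply/eqP/(h i); rewrite mem_index_enum.
Qed.
Lemma nrm_gt0 n (x : 'cV[F]_n) : x != 0 -> 0 < nrm x.
Proof.
by move=> x0; rewrite lt_def nrm_ge0 andbT; apply: contra_neq x0 => /nrm_eq0.
Qed.
Lemma dot_neq0 n (x : 'cV[F]_n) : x != 0 -> dot x x != 0.
Proof. by move=> /nrm_gt0 h; rewrite nrmE inj_eq0 gt_eqF. Qed.
Lemma re_dotC n (x y : 'cV[F]_n) : re (dot x y) = re (dot y x).
Proof. by rewrite dotC re_cjE. Qed.
Lemma nrmZ n (a : R) (x : 'cV[F]_n) : nrm (inj a *: x) = a ^+ 2 * nrm x.
Proof. by rewrite /nrm dotZr dotZl cj_inj !reZ mulrA. Qed.

(** Unitarity, not to be confused with [unitmx], which is invertibility. *)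
Definition unit_mx n (A : 'M[F]_n) := A^h *m A = 1%:M.

Lemma unit_mxC n (A : 'M[F]_n) : unit_mx A -> A *m A^h = 1%:M.
Proof. exact: mulmx1C. Qed.
Lemma unit_mx_ct n (A : 'M[F]_n) : unit_mx A -> unit_mx A^h.
Proof. by move=> /unit_mxC; rewrite /unit_mx ctK. Qed.
Lemma unit_mxM n (A B : 'M[F]_n) : unit_mx A -> unit_mx B -> unit_mx (A *m B).
Proof.
by move=> hA hB; rewrite /unit_mx ctM mulmxA -[_ *m A]mulmxA hA mulmx1.
Qed.
Lemma unit_mx1 n : unit_mx (1%:M : 'M[F]_n).
Proof. by rewrite /unit_mx ct1 mulmx1. Qed.

Lemma rank1_update_mul n (z : 'cV[F]_n) a b :
  (1%:M - a *: (z *m z^h)) *m (1%:M - b *: (z *m z^h)) =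
  1%:M - (a + b - a * b * dot z z) *: (z *m z^h).
Proof.
rewrite mulmxBl mul1mx mulmxBr mulmx1 -scalemxAl -scalemxAr.
rewrite mulmxA -[z *m z^h *m z]mulmxA dotE mul_mx_scalar -scalemxAl !scalerA.
rewrite opprB -!scaleNr -!addrA -!scalerDl; congr (_ + _ *: _); ring.
Qed.

(* [1 - z z^h / (z^h v)] with [z = v - u] sends [v] to [u], and it is unitary
   because [z^h v + v^h z = |z|^2] when [|u| = |v|]. *)
Lemma unitary_move n (u v : 'cV[F]_n) : nrm u = nrm v ->
  exists2 W, unit_mx W & W *m v = u /\
     forall x, dot u x = 0 -> dot v x = 0 -> W *m x = x.
Proof.
move=> huv; pose z := v - u; have [zv|zv] := eqVneq (dot z v) 0.
  have zz : dot z z = dot z v + dot v z.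
    by rewrite /z !(dotDr,dotDl,dotNr,dotNl) !nrmE huv; ring.
  have z0 : z = 0.
    by apply/nrm_eq0; rewrite /nrm zz reD [dot v z]dotC re_cjE zv re0 addr0.
  exists 1%:M; first exact: unit_mx1.
  by split=> [|x _ _]; rewrite mul1mx //; apply/eqP; rewrite -subr_eq0 -/z z0.
pose W := 1%:M - (dot z v)^-1 *: (z *m z^h).
have Wx x : W *m x = x - (dot z x / dot z v) *: z.
  rewrite mulmxBl mul1mx -scalemxAl -mulmxA dotE mul_mx_scalar scalerA.
  by rewrite [X in X *: z]mulrC.
exists W; last split.
- have vz : dot v z != 0 by rewrite dotC fmorph_eq0.
  have zz : dot z z = dot z v + dot v z.
    by rewrite /z !(dotDr,dotDl,dotNr,dotNl) !nrmE huv; ring.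
  rewrite /unit_mx ctB ct1 ctZ ctM ctK fmorphV -dotC.
  rewrite rank1_update_mul zz [X in _ - X *: _](_ : _ = 0) ?scale0r ?subr0 //.
  by field; rewrite vz zv.
- by rewrite Wx divff // scale1r opprB addrC subrK.
- by move=> x ux vx; rewrite Wx /z dotDl dotNl ux vx subr0 mul0r scale0r subr0.
Qed.

(** The first unitary sends [v] to [u]. The second sends the image of [v'] to [u'] and fixes [u],
    which is orthogonal to both. *)
Lemma unitary_move2 n (u v u' v' : 'cV[F]_n) : nrm u = nrm v -> nrm u' = nrm v' ->
  dot u u' = 0 -> dot v v' = 0 ->
  exists2 W, unit_mx W & W *m v = u /\ W *m v' = u'.
Proof.
move=> h h' uu vv; have [W W1 [Wv _]] := unitary_move h.
have [|W' W'1 [W'v W'x]] := @unitary_move _ u' (W *m v').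
  by rewrite h' /nrm dot_mull mulmxA W1 mul1mx.
exists (W' *m W); first exact: unit_mxM.
rewrite -!mulmxA Wv; split=> //; apply: W'x.
  by rewrite dotC uu rmorph0.
by rewrite -Wv dot_mull mulmxA W1 mul1mx dotC vv rmorph0.
Qed.

(** This is the Householder reflection along [v]: for [a = 2 / |v|^2] the coefficient
    [2 a - a^2 |v|^2] vanishes. *)
Lemma unit_reflection n (v : 'cV[F]_n) : v != 0 ->
  unit_mx (1%:M - inj (2 / nrm v) *: (v *m v^h)).
Proof.
move=> v0; have nv := nrm_gt0 v0.
rewrite /unit_mx ctB ct1 ctZr ctM ctK.
rewrite rank1_update_mul nrmE -!rmorphM -!rmorphD -rmorphB.
rewrite [X in inj X](_ : _ = 0) ?rmorph0 ?scale0r ?subr0 //.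
by field; rewrite gt_eqF.
Qed.

Definition scal n (A : 'M[F]_n) := exists r : R, A = (inj r)%:M.

Lemma scalD n (A B : 'M[F]_n) : scal A -> scal B -> scal (A + B).
Proof. by move=> [a ->] [b ->]; exists (a + b); rewrite rmorphD raddfD. Qed.
Lemma scalZ n a (A : 'M[F]_n) : scal A -> scal (inj a *: A).
Proof. by move=> [b ->]; exists (a * b); rewrite rmorphM scale_scalar_mx. Qed.
Lemma scalN n (A : 'M[F]_n) : scal A -> scal (- A).
Proof. by move=> [b ->]; exists (- b); rewrite rmorphN raddfN. Qed.
Lemma scalB n (A B : 'M[F]_n) : scal A -> scal B -> scal (A - B).
Proof. by move=> ha hb; apply: scalD => //; apply: scalN. Qed.
Lemma scal0 n : scal (0 : 'M[F]_n).
Proof. by exists 0; rewrite rmorph0 raddf0. Qed.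
Lemma scal_sum n (I : Type) (r : seq I) (P : pred I) (f : I -> 'M[F]_n) :
  (forall i, P i -> scal (f i)) -> scal (\sum_(i <- r | P i) f i).
Proof. by move=> h; elim/big_ind: _ => //; [apply: scal0 | apply: scalD]. Qed.
Lemma scalZK n a (A : 'M[F]_n) : a != 0 -> scal (inj a *: A) -> scal A.
Proof.
move=> a0 /(@scalZ _ a^-1); rewrite scalerA -rmorphM mulVf // rmorph1.
by rewrite scale1r.
Qed.
Lemma scal_conj n (P Q A : 'M[F]_n) : Q *m P = 1%:M -> scal A -> scal (P *m A *m Q).
Proof.
move=> PQ [a ->]; exists a; rewrite mul_mx_scalar -scalemxAl (mulmx1C PQ).
by rewrite scalemx1.
Qed.

(** Testing [e_i] makes [H] diagonal, testing [e_i + e_j] makes the diagonal constant, and Hermitian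
    symmetry makes the constant real. *)
Lemma scal_line n (H : 'M[F]_n) : H^h = H ->
  (forall x : 'cV_n, exists a, H *m x = a *: x) -> scal H.
Proof.
case: n H => [|n] H Hh h.
  by exists 0; rewrite !flatmx0.
have hd i : H *m (delta_mx i 0 : 'cV_n.+1) = H i i *: delta_mx i 0.
  have [a ha] := h (delta_mx i 0 : 'cV_n.+1); rewrite ha; congr (_ *: _).
  by move/matrixP: ha => /(_ i 0); rewrite -colE !mxE !eqxx mulr1.
have off i j : i != j -> H i j = 0.
  move=> ij; move/matrixP: (hd j) => /(_ i 0).
  by rewrite -colE !mxE (negPf ij) mulr0.
have eqd i j : i != j -> H i i = H j j.
  move=> ij; have [a] := h (delta_mx i 0 + delta_mx j 0 : 'cV_n.+1).
  rewrite mulmxDr !hd scalerDr => /matrixP e.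
  move: (e i 0) (e j 0); rewrite !mxE !eqxx (negPf ij) eq_sym (negPf ij) /=.
  by rewrite !mulr0 !mulr1 !addr0 !add0r => -> ->.
exists (re (H 0 0)); rewrite -self_adjoint; last first.
  by move/matrixP: Hh => /(_ 0 0); rewrite ctE.
apply/matrixP=> i j; rewrite mxE; have [<-|ij] := eqVneq i j; last exact: off.
by have [->//|i0] := eqVneq i 0; rewrite (eqd _ _ i0).
Qed.

End ConjTranspose.
Notation "A ^h" := (ct A) (at level 2, format "A ^h") : ring_scope.

(** * Real-linear maps and counting of real equations *)

Section RealLinear.
Variables (R : rcfType) (F : starField R).

Definition rlin (V W : lmodType F) (T : V -> W) :=
  forall a x y, T (inj a *: x + y) = inj a *: T x + T y.

Definition rfun (V : lmodType F) (f : V -> R) :=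
  forall a x y, f (inj a *: x + y) = a * f x + f y.

Section Rlin.
Variables (V W : lmodType F) (T : V -> W).
Hypothesis lT : rlin T.

Lemma rlinD x y : T (x + y) = T x + T y.
Proof. by rewrite -[x]scale1r -(rmorph1 inj) lT rmorph1 !scale1r. Qed.
Lemma rlin0 : T 0 = 0.
Proof. by apply: (addrI (T 0)); rewrite -rlinD !addr0. Qed.
Lemma rlinZ a x : T (inj a *: x) = inj a *: T x.
Proof. by rewrite -[inj a *: x]addr0 lT rlin0 addr0. Qed.
Lemma rlinN x : T (- x) = - T x.
Proof. by apply/eqP; rewrite -addr_eq0 -rlinD addNr rlin0. Qed.
Lemma rlinB x y : T (x - y) = T x - T y.
Proof. by rewrite rlinD rlinN. Qed.
Lemma rlin_sum (I : Type) (r : seq I) (P : pred I) (f : I -> V) :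
  T (\sum_(i <- r | P i) f i) = \sum_(i <- r | P i) T (f i).
Proof. by elim/big_rec2: _ => [|i a b _ <-]; rewrite ?rlin0 ?rlinD. Qed.
End Rlin.

Section Rfun.
Variables (V : lmodType F) (f : V -> R).
Hypothesis lf : rfun f.

Lemma rfunD x y : f (x + y) = f x + f y.
Proof. by rewrite -[x]scale1r -(rmorph1 inj) lf rmorph1 scale1r mul1r. Qed.
Lemma rfun0 : f 0 = 0.
Proof. by apply: (addrI (f 0)); rewrite -rfunD !addr0. Qed.
Lemma rfunZ a x : f (inj a *: x) = a * f x.
Proof. by rewrite -[inj a *: x]addr0 lf rfun0 addr0. Qed.
Lemma rfun_sum (I : Type) (r : seq I) (P : pred I) (g : I -> V) :
  f (\sum_(i <- r | P i) g i) = \sum_(i <- r | P i) f (g i).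
Proof. by elim/big_rec2: _ => [|i a b _ <-]; rewrite ?rfun0 ?rfunD. Qed.
End Rfun.

(** The rank of the coefficient matrix is at most [#|J|], so its row kernel is nonzero. *)
Lemma underdetermined (I J : finType) (A : I -> J -> R) : (#|J| < #|I|)%N ->
  exists c : I -> R, (exists i, c i != 0) /\ forall j, \sum_i c i * A i j = 0.
Proof.
move=> lt; pose M := \matrix_(i < #|I|, j < #|J|) A (enum_val i) (enum_val j).
have /rowV0Pn[v /sub_kermxP vM v0] : kermx M != 0.
  by rewrite kermx_eq0 -row_leq_rank -ltnNge (leq_ltn_trans (rank_leq_col _)).
exists (fun i => v 0 (enum_rank i)); split.
  have [i vi] : exists i, v 0 i != 0.
    apply: contrapT => h; case/eqP: v0; apply/rowP=> i; rewrite mxE.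
    by apply/eqP/negPn/negP => vi; apply: h; exists i.
  by exists (enum_val i); rewrite enum_valK.
move=> j; move/rowP: vM => /(_ (enum_rank j)); rewrite !mxE => h.
rewrite (reindex (enum_val : 'I_#|I| -> I)) /=.
  rewrite -[RHS]h; apply: eq_bigr => i _.
  by rewrite mxE enum_valK enum_rankK.
by apply: onW_bij; apply: enum_val_bij.
Qed.

Definition real_basis p q (t : 'I_p * 'I_q * 'I_(dim F).+1) : 'M[F]_(p, q) :=
  vec t.2 *: delta_mx t.1.1 t.1.2.

Lemma real_basis_free p q (c : 'I_p * 'I_q * 'I_(dim F).+1 -> R) t :
  \sum_s inj (c s) *: real_basis s = 0 -> c t = 0.
Proof.
case: t => -[i j] k /matrixP /(_ i j); rewrite summxE mxE => h.
rewrite -(coord_sum (fun k => c (i, j, k)) k) -[RHS](coord0 k) -[in RHS]h.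
congr coord.
pose g (s : 'I_p * 'I_q) l : F :=
  inj (c (s, l)) * (vec l * ((i == s.1) && (j == s.2))%:R).
rewrite [RHS](eq_bigr (fun t => g t.1 t.2)) => [|[s l] _]; last by rewrite !mxE.
rewrite -(pair_bigA _ g) /= (bigD1 (i, j)) //= [X in _ = _ + X]big1 ?addr0.
  by apply: eq_bigr => l _; rewrite /g !eqxx mulr1.
move=> [a b] /= ab; apply: big1 => l _; rewrite /g /= [i == a]eq_sym [j == b]eq_sym.
by rewrite -xpair_eqE (negPf ab) !mulr0.
Qed.

Lemma solve_real_system p q (J : finType) (f : J -> 'M[F]_(p, q) -> R) :
  (forall j, rfun (f j)) -> (#|J| < p * q * (dim F).+1)%N ->
  exists2 Y, Y != 0 & forall j, f j Y = 0.
Proof.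
move=> lf lt.
have [|c [[t c0] ce]] := @underdetermined ('I_p * 'I_q * 'I_(dim F).+1)%type
   J (fun t j => f j (real_basis t)).
  by rewrite !card_prod !card_ord.
exists (\sum_t inj (c t) *: real_basis t).
  by apply: contra_neq c0; apply: real_basis_free.
move=> l; rewrite rfun_sum //; rewrite -[RHS](ce l).
by apply: eq_bigr => s _; rewrite rfunZ.
Qed.

(* [y] is orthogonal to the image, so adjoining it to [u |-> f u] gives
   one more unknown than real equations. *)
Lemma injective_dense n (f : 'cV[F]_n -> 'cV[F]_n) y : rlin f ->
  (forall u, f u = 0 -> u = 0) -> (forall u, re (dot (f u) y) = 0) -> y = 0.
Proof.
move=> lf f_inj fy.
have [|c [[i c0] ce]] := @underdetermined ('I_n * 'I_1 * 'I_(dim F).+1 + unit)%type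
    ('I_n * 'I_(dim F).+1)%type
    (fun t j => if t is inl s then coord j.2 (f (real_basis s) j.1 0)
                else coord j.2 (y j.1 0)).
  by rewrite card_sum card_unit !card_prod !card_ord muln1 addn1.
pose u := \sum_t inj (c (inl t)) *: real_basis t; pose s := c (inr tt).
have fu : f u = - (inj s *: y).
  apply/eqP; rewrite -addr_eq0; apply/eqP/matrixP=> a b.
  rewrite ord1 [RHS]mxE; apply: coord_eq0 => k.
  have := ce (a, k); rewrite big_sumType /= (big_pred1 tt) => [<-|[] //].
  rewrite !mxE coordD coordZ; congr (_ + _).
  have lg : rfun (fun v => coord k (f v a 0)).
    by move=> r v w; rewrite lf !mxE coord_lin.
  by rewrite (rfun_sum lg); apply: eq_bigr => t _; rewrite (rfunZ lg).
have u0 : u = 0.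
  by apply/f_inj/nrm_eq0; rewrite /nrm {2}fu dotNr dotZr reN reZ fy mulr0 oppr0.
have s0 : s != 0.
  by case: i c0 => [i|[] //] ci; rewrite (real_basis_free i u0) eqxx in ci.
move/eqP: fu; rewrite u0 (rlin0 lf) eq_sym oppr_eq0 scaler_eq0 inj_eq0 (negPf s0).
by move/eqP.
Qed.

End RealLinear.

(** * The polarized identity on orthogonal rank one matrices *)

Section Preservers.
Variables (R : rcfType) (F : starField R).

(** Asking for both products makes the class closed under taking adjoints of the values, so facts
    about left products transfer to right products. *)
Record preserver n (T : 'M[F]_n -> 'M[F]_n) : Prop := Preserver {
  pres_lin : rlin T;
  pres_inj : forall X, T X = 0 -> X = 0;
  pres_surj : forall Y, exists X, T X = Y;
  pres_ctl : forall X, unit_mx X -> scal ((T X)^h *m T X);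
  pres_ctr : forall X, unit_mx X -> scal (T X *m (T X)^h)
}.

Lemma rlin_ct m n : rlin (@ct R F m n).
Proof. by move=> a X Y; rewrite ctD ctZr. Qed.

Lemma preserver_ctl n (T : 'M[F]_n -> 'M[F]_n) :
  preserver T -> preserver (fun X => (T X)^h).
Proof.
case=> lT Ti Ts h1 h2; split.
- by move=> a X Y; rewrite lT rlin_ct.
- by move=> X /ct_eq0 /Ti.
- by move=> Y; have [X h] := Ts Y^h; exists X; rewrite h ctK.
- by move=> X /h2; rewrite ctK.
- by move=> X /h1; rewrite ctK.
Qed.

Lemma preserver_ctr n (T : 'M[F]_n -> 'M[F]_n) :
  preserver T -> preserver (fun X => T X^h).
Proof.
case=> lT Ti Ts h1 h2; split.
- by move=> a X Y; rewrite rlin_ct lT.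
- by move=> X /Ti /ct_eq0.
- by move=> Y; have [X h] := Ts Y; exists X^h; rewrite ctK.
- by move=> X /unit_mx_ct /h1.
- by move=> X /unit_mx_ct /h2.
Qed.

Lemma preserver_mul n (T : 'M[F]_n -> 'M[F]_n) P Q S : preserver T ->
  unit_mx P -> unit_mx Q -> unit_mx S ->
  preserver (fun X => T (P *m X *m Q) *m S).
Proof.
case=> lT Ti Ts h1 h2 hP hQ hS; split.
- by move=> a X Y; rewrite mulmxDr mulmxDl -scalemxAr -scalemxAl lT mulmxDl -scalemxAl.
- move=> X h; have /Ti h' : T (P *m X *m Q) = 0.
    by rewrite -[LHS]mulmx1 -(unit_mxC hS) mulmxA h mul0mx.
  rewrite -[X]mulmx1 -(unit_mxC hQ) mulmxA -[X]mul1mx -hP.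
  by rewrite -!mulmxA (mulmxA X) (mulmxA P) (mulmxA P) h' mul0mx mulmx0.
- move=> Y; have [X h] := Ts (Y *m S^h); exists (P^h *m X *m Q^h).
  rewrite !mulmxA (unit_mxC hP) mul1mx -mulmxA hQ mulmx1 h -mulmxA hS mulmx1 //.
- move=> X hX; rewrite ctM mulmxA -[_ *m _ *m T _]mulmxA.
  apply: scal_conj; first exact: unit_mxC.
  by apply: h1; apply: unit_mxM => //; apply: unit_mxM.
- move=> X hX; rewrite ctM mulmxA -[_ *m S *m _]mulmxA (unit_mxC hS) mulmx1.
  by apply: h2; apply: unit_mxM => //; apply: unit_mxM.
Qed.

(** Polarization without the factor 1/2: [polar T X X] is twice [(T X)^h *m T X]. *)
Definition polar n (T : 'M[F]_n -> 'M[F]_n) X Y :=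
  (T X)^h *m T Y + (T Y)^h *m T X.

Section Polar.
Variables (n : nat) (T : 'M[F]_n -> 'M[F]_n).
Hypothesis lT : rlin T.

Lemma polarC X Y : polar T X Y = polar T Y X.
Proof. by rewrite /polar addrC. Qed.
Lemma polar_linr X : rlin (polar T X).
Proof.
move=> a Y Z; rewrite /polar lT rlin_ct mulmxDr mulmxDl -scalemxAl -scalemxAr.
by rewrite scalerDr addrACA.
Qed.
Lemma polar_linl X : rlin (polar T ^~ X).
Proof. by move=> a Y Z; rewrite polarC polar_linr polarC [polar _ Z _]polarC. Qed.

Lemma second_difference (A a b : 'M[F]_n) :
  a^h *m b + b^h *m a =
  (A - a - b)^h *m (A - a - b) - (A - a)^h *m (A - a) - (A - b)^h *m (A - b)
    + A^h *m A.
Proof.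
rewrite !ctB !(mulmxBl, mulmxBr).
move: (A^h *m A) (A^h *m a) (A^h *m b) (a^h *m A) (a^h *m a) (a^h *m b).
move: (b^h *m A) (b^h *m a) (b^h *m b) => *.
by apply/matrixP=> i j; rewrite !mxE; ring.
Qed.
End Polar.

Lemma sqrt_scale n (u v : 'cV[F]_n) : u != 0 -> v != 0 ->
  exists2 r, 0 < r & nrm (inj r *: u) = nrm v.
Proof.
move=> /nrm_gt0 u0 /nrm_gt0 v0; exists (Num.sqrt (nrm v / nrm u)).
  by rewrite sqrtr_gt0 divr_gt0.
by rewrite nrmZ sqr_sqrtr ?divr_ge0 ?ltW // divfK // gt_eqF.
Qed.

(** After rescaling, a unitary [W] sends [v] to [r u] and [v'] to [s u']. Multiplying [W] by the
    reflections along [v] and [v'] subtracts real multiples [a] of [u v^h] and [b] of [u' v'^h]. So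
    [W], [W - a], [W - b] and [W - a - b] are unitary, and the second difference is scalar. *)
Lemma polar_scal n (T : 'M[F]_n -> 'M[F]_n) (u v u' v' : 'cV[F]_n) :
  preserver T -> dot u u' = 0 -> dot v v' = 0 ->
  scal (polar T (u *m v^h) (u' *m v'^h)).
Proof.
move=> gT uu vv; have lT := pres_lin gT.
have lL X := polar_linl lT X; have lR X := polar_linr lT X.
have z1 Y : scal (polar T 0 Y) by rewrite (rlin0 (lL Y)); apply: scal0.
have z2 X : scal (polar T X 0) by rewrite (rlin0 (lR X)); apply: scal0.
have [->|u0] := eqVneq u 0; first by rewrite mul0mx.
have [->|v0] := eqVneq v 0; first by rewrite ct0 mulmx0.
have [->|u'0] := eqVneq u' 0; first by rewrite mul0mx.
have [->|v'0] := eqVneq v' 0; first by rewrite ct0 mulmx0.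
have [r r0 hr] := sqrt_scale u0 v0; have [s s0 hs] := sqrt_scale u'0 v'0.
have [|W W1 [Wv Wv']] := unitary_move2 hr hs _ vv.
  by rewrite dotZr dotZl uu !mulr0.
pose a := inj (2 / nrm v * r) *: (u *m v^h).
pose b := inj (2 / nrm v' * s) *: (u' *m v'^h).
pose Ra := 1%:M - inj (2 / nrm v) *: (v *m v^h).
pose Rb := 1%:M - inj (2 / nrm v') *: (v' *m v'^h).
have ha : W - a = W *m Ra.
  by rewrite mulmxBr mulmx1 -scalemxAr mulmxA Wv -scalemxAl scalerA -rmorphM.
have hb : W - b = W *m Rb.
  by rewrite mulmxBr mulmx1 -scalemxAr mulmxA Wv' -scalemxAl scalerA -rmorphM.
(* Since [v] and [v'] are orthogonal, the product of the two reflections has no cross term. *)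
have hab : W - a - b = W *m (Ra *m Rb).
  rewrite mulmxA -ha mulmxBr mulmx1 -scalemxAr mulmxA mulmxBl Wv'.
  rewrite -[_ *: _ *m v']scalemxAl -mulmxA dotE vv raddf0 mulmx0 scaler0 subr0.
  by rewrite -scalemxAl scalerA -rmorphM.
have uRa : unit_mx Ra by apply: unit_reflection.
have uRb : unit_mx Rb by apply: unit_reflection.
have key : scal (polar T a b).
  rewrite /polar (second_difference (T W)) -!(rlinB lT) hab ha hb.
  apply: scalD; [apply: scalB; [apply: scalB|]|]; apply: (pres_ctl gT) => //.
  - by do 2!apply: unit_mxM => //.
  - exact: unit_mxM.
  - exact: unit_mxM.
move: key; rewrite /a /b (rlinZ (lL _)) (rlinZ (lR _)).
have nz (w : 'cV[F]_n) t : w != 0 -> 0 < t -> 2 / nrm w * t != 0 :> R.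
  by move=> w0 t0; rewrite mulf_neq0 ?gt_eqF ?divr_gt0 ?nrm_gt0 ?ltr0Sn.
by move=> /(scalZK (nz _ _ v0 r0)) /(scalZK (nz _ _ v'0 s0)).
Qed.

Lemma delta_mul m n (i : 'I_m) (j : 'I_n) a :
  a *: delta_mx i j = (a *: delta_mx i 0 : 'cV[F]_m) *m (delta_mx j 0 : 'cV[F]_n)^h.
Proof. by rewrite -scalemxAl ct_delta mul_delta_mx. Qed.

Lemma dot_delta n (i j : 'I_n) : i != j ->
  dot (delta_mx i 0 : 'cV[F]_n) (delta_mx j 0) = 0.
Proof. by move=> ij; rewrite /dot ct_delta mul_delta_mx_0 // mxE. Qed.

Lemma polar_corner_scal n (T : 'M[F]_n.+1 -> 'M[F]_n.+1) (Y : 'M_n.+1) :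
  preserver T ->
  (forall i, Y i 0 = 0) -> (forall j, Y 0 j = 0) -> scal (polar T (delta_mx 0 0) Y).
Proof.
move=> gT hc hr; have lR X := polar_linr (pres_lin gT) X.
rewrite [Y]matrix_sum_delta (rlin_sum (lR _)); apply: scal_sum => i _.
rewrite (rlin_sum (lR _)); apply: scal_sum => j _.
have [->|i0] := eqVneq i 0; first by rewrite hr scale0r (rlin0 (lR _)); apply: scal0.
have [->|j0] := eqVneq j 0; first by rewrite hc scale0r (rlin0 (lR _)); apply: scal0.
rewrite delta_mul -[delta_mx 0 0]scale1r delta_mul scale1r.
by apply: polar_scal => //; rewrite ?dotZr dot_delta ?mulr0 // eq_sym.
Qed.

End Preservers.

(** * Images of rank one matrices are singular *)

Section Invertible.
Variables (R : rcfType) (F : starField R).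

(** With [H = M^h M] and [G = M^h N], the two relations give
    [H G = - M^h M N^h M = M^h N M^h M = G H]. *)
Lemma commute_of_skew n (M N : 'M[F]_n) : M^h *m N + N^h *m M = 0 ->
  M *m N^h + N *m M^h = 0 -> (M^h *m M) *m (M^h *m N) = (M^h *m N) *m (M^h *m M).
Proof.
move=> /eqP; rewrite addr_eq0 => /eqP h1 /eqP; rewrite addr_eq0 => /eqP h2.
rewrite h1 mulmxN mulNmx; congr (- _).
rewrite mulmxA -(mulmxA M^h M) h2 mulmxN mulNmx mulmxA h1.
by rewrite mulNmx mulNmx opprK -!mulmxA.
Qed.

Definition corner_mx m (Y : 'M[F]_m) : 'M[F]_m.+1 :=
  \matrix_(i, j) if unlift 0 i is Some a then
    if unlift 0 j is Some b then Y a b else 0 else 0.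

Lemma corner_lin m : rlin (@corner_mx m).
Proof.
move=> a X Y; apply/matrixP=> i j; rewrite !mxE.
by case: unlift => [?|]; [case: unlift => [?|]|]; rewrite ?mxE ?mulr0 ?addr0.
Qed.
Lemma corner_col0 m (Y : 'M[F]_m) i : corner_mx Y i 0 = 0.
Proof. by rewrite mxE unlift_none; case: unlift. Qed.
Lemma corner_row0 m (Y : 'M[F]_m) j : corner_mx Y 0 j = 0.
Proof. by rewrite mxE unlift_none. Qed.
Lemma corner_eq0 m (Y : 'M[F]_m) : corner_mx Y = 0 -> Y = 0.
Proof.
move=> /matrixP h; apply/matrixP=> i j.
by have := h (lift 0 i) (lift 0 j); rewrite !mxE !liftK.
Qed.

(* The counting step: the matrices supported on the lower right block form a
   space of dimension [d (n-1)^2], and [d n (n-2) + (d-1)] real equations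
   force [G = M^h T(Y)] to vanish. *)
Lemma corner_offdiag m (T : 'M[F]_m.+3 -> 'M[F]_m.+3) (j : 'I_m.+3) : preserver T ->
  T (delta_mx 0 0) \in unitmx -> j != 0 ->
  ((T (delta_mx 0 0))^h *m T (delta_mx 0 0)) j 0 = 0.
Proof.
set M := T _ => gT uM j0; set H := M^h *m M.
apply/eqP/negPn/negP => Hj.
(* A third index exists because the size is at least 3. *)
have [k k0 kj] : exists2 k : 'I_m.+3, k != 0 & k != j.
  have : (0 < #|[set~ j] :\ 0%R|)%N.
    have := cardsD1 (0%R : 'I_m.+3) [set~ j]; rewrite cardsC1 card_ord !inE.
    by rewrite eq_sym j0 /= add1n => -[<-]; exact: ltn0Sn.
  by case/card_gt0P => k; rewrite !inE => /andP[k0 kj]; exists k.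
pose G Y := M^h *m T (corner_mx Y).
have lG : rlin G.
  by move=> a X Y; rewrite /G corner_lin (pres_lin gT) mulmxDr -scalemxAr.
(* The left summand kills every column of [G Y] except [j] and [k]; the right one kills the non-real
   coordinates of [G Y k k]. This is exactly one equation fewer than there are unknowns. *)
pose J := ({i | i \in [set~ j] :\ k} * 'I_m.+3 * 'I_(dim F).+1 + 'I_(dim F))%type.
pose f (t : J) (Y : 'M[F]_m.+2) := match t with
  | inl s => coord s.2 (G Y s.1.2 (val s.1.1))
  | inr l => coord (lift ord0 l) (G Y k k) end.
have [||Y Y0 hY] := @solve_real_system R F m.+2 m.+2 J f.
- by case=> [s|l] a X Y; rewrite /f lG !mxE coord_lin.
- rewrite card_sum !card_prod !card_ord card_sig.
  have -> : #|[pred i | i \in [set~ j] :\ k]| = m.+1.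
    have := cardsD1 k [set~ j]; rewrite cardsC1 card_ord !inE kj /=.
    rewrite add1n => -[e]; rewrite [RHS]e.
    by apply: eq_card => i; rewrite !inE.
  by nia.
pose N := T (corner_mx Y).
have [t ht] : scal (polar T (delta_mx 0 0) (corner_mx Y)).
  by apply: polar_corner_scal => // i; rewrite ?corner_col0 ?corner_row0.
have [s hs] : scal (polar (fun X => (T X)^h) (delta_mx 0 0) (corner_mx Y)).
  apply: polar_corner_scal; first exact: preserver_ctl.
    by move=> i; rewrite corner_col0.
  by move=> i; rewrite corner_row0.
rewrite /polar !ctK -/M -/N in ht hs; set G0 := G Y; have GE : G0 = M^h *m N by [].
have GhE : G0^h = N^h *m M by rewrite GE ctM ctK.
have col i l : i != j -> i != k -> G0 l i = 0.
  move=> ij ik; apply: coord_eq0 => c.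
  have ijk : i \in [set~ j] :\ k by rewrite !inE ij ik.
  exact: (hY (inl (exist _ i ijk, l, c))).
(* Column 0 of [G0] is among those killed, so the corner entry of the scalar matrix is zero. *)
have t0 : t = 0.
  have /matrixP/(_ 0 0) := ht; rewrite -GhE -GE [LHS]mxE ctE [RHS]mxE.
  rewrite col 1?eq_sym // rmorph0 addr0 eqxx mulr1n => /esym/eqP.
  by rewrite inj_eq0 => /eqP.
(* By cyclicity both polarizations have the same trace. *)
have s0 : s = 0.
  have /eqP : \tr (M *m N^h + N *m M^h) = \tr (M^h *m N + N^h *m M).
    by rewrite !mxtraceD addrC mxtrace_mulC [X in _ + X]mxtrace_mulC.
  rewrite hs ht t0 rmorph0 mxtrace_scalar raddf0 mxtrace0.
  rewrite -mulr_natr -(rmorph_nat inj) -rmorphM inj_eq0 mulf_eq0 pnatr_eq0 orbF.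
  by move/eqP.
rewrite t0 rmorph0 raddf0 in ht; rewrite s0 rmorph0 raddf0 in hs.
have comm := commute_of_skew ht hs; rewrite -GE -/H in comm.
have skew a b : G0 a b = - cj (G0 b a).
  have /matrixP/(_ a b) := ht; rewrite -GhE -GE [RHS]mxE [LHS]mxE ctE.
  by move/eqP; rewrite addr_eq0 => /eqP.
have Gkk : G0 k k = 0.
  apply: coord_eq0 => c; case: (unliftP 0 c) => [l|] ->; first exact: (hY (inr l)).
  have := congr1 (@re R F) (skew k k); rewrite reN re_cjE => /eqP.
  by rewrite -addr_eq0 -mulr2n mulrn_eq0 /= => /eqP.
(* Entry [(i, 0)] of [H G0 = G0 H]: the left side vanishes with column 0 of [G0], and on the right
   only columns [j] and [k] contribute. *)
have Gj i : G0 i j * H j 0 + G0 i k * H k 0 = 0.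
  move/matrixP: comm => /(_ i 0); rewrite mxE big1; last first.
    by move=> l _; rewrite [G0 l 0]col ?mulr0 // eq_sym.
  rewrite mxE (bigD1 j) //= (bigD1 k) //= big1 ?addr0 //.
  by move=> l /andP[lj lk]; rewrite col ?mul0r.
have Gjcol i : G0 i k = 0 -> G0 i j = 0.
  move=> ik; have := Gj i; rewrite ik mul0r addr0 => /eqP.
  by rewrite mulf_eq0 (negPf Hj) orbF => /eqP.
have Gjk : G0 j k = 0 by rewrite skew Gjcol // rmorph0 oppr0.
(* Skewness turns zero columns into zero rows, and [Gjcol] passes zeros from column [k] to column
   [j]; together they clear the two remaining columns. *)
have Gz : G0 = 0.
  apply/matrixP=> a b; rewrite [RHS]mxE.
  have [->|bj] := eqVneq b j; last have [->|bk] := eqVneq b k; last exact: col.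
    have [->|aj] := eqVneq a j; first exact: Gjcol.
    have [->|ak] := eqVneq a k; first exact: Gjcol.
    by rewrite skew col // rmorph0 oppr0.
  have [->//|aj] := eqVneq a j.
  have [->//|ak] := eqVneq a k.
  by rewrite skew col // rmorph0 oppr0.
case/eqP: Y0; apply/corner_eq0/(pres_inj gT); rewrite -/N.
have uMh : M^h \in unitmx by rewrite unitmx_tr map_unitmx.
by rewrite -[N](mulKmx uMh) -GE Gz mulmx0.
Qed.
End Invertible.

Section Singular.
Variables (R : rcfType) (F : starField R).

Lemma unitary_column n (x : 'cV[F]_n.+1) : x != 0 ->
  exists W r, [/\ unit_mx W, 0 < r & x = inj r *: (W *m delta_mx 0 0)].
Proof.
have e0 : (delta_mx 0 0 : 'cV[F]_n.+1) != 0.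
  by apply/eqP=> /matrixP/(_ 0 0)/eqP; rewrite !mxE !eqxx oner_eq0.
move=> x0; have [r r0 hr] := sqrt_scale e0 x0.
have [W W1 [Wx _]] := unitary_move (esym hr).
by exists W, r; split; rewrite // scalemxAr.
Qed.

(** Multiplying [T] on the right by a unitary [W] replaces [H] by [W^h H W], so [corner_offdiag]
    makes [W e_0] an eigenvector of [H]. Every nonzero vector is a multiple of some [W e_0]. *)
Lemma corner_scal m (T : 'M[F]_m.+3 -> 'M[F]_m.+3) : preserver T ->
  T (delta_mx 0 0) \in unitmx ->
  scal ((T (delta_mx 0 0))^h *m T (delta_mx 0 0)).
Proof.
set M := T _ => gT uM; set H := M^h *m M.
apply: scal_line; first by rewrite ctM ctK.
move=> x; have [->|x0] := eqVneq x 0; first by exists 0; rewrite mulmx0 scaler0.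
have [W [r [W1 r0 ->]]] := unitary_column x0.
pose T' X := T (1%:M *m X *m 1%:M) *m W.
have gT' : preserver T' by apply: preserver_mul => //; apply: unit_mx1.
have T'0 : T' (delta_mx 0 0) = M *m W by rewrite /T' mul1mx mulmx1.
have uW : W \in unitmx by case: (mulmx1_unit W1).
have off j : j != 0 -> (W^h *m H *m W) j 0 = 0.
  move=> j0; have := corner_offdiag gT' _ j0; rewrite T'0 ctM !mulmxA.
  by apply; rewrite unitmx_mul uM.
exists ((W^h *m H *m W) 0 0).
rewrite -scalemxAr scalerA mulrC -scalerA; congr (_ *: _).
pose e : 'cV[F]_m.+3 := delta_mx 0 0.
have -> : H *m (W *m e) = W *m ((W^h *m H *m W) *m e).
  by rewrite !mulmxA (unit_mxC W1) mul1mx.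
rewrite scalemxAr; congr (_ *m _); rewrite -colE; apply/matrixP=> i j.
rewrite ord1 mxE [RHS]mxE [X in _ * X]mxE; have [->|i0] := eqVneq i 0.
  by rewrite eqxx mulr1.
by rewrite off // mulr0.
Qed.

Lemma rank1_scal m (T : 'M[F]_m.+3 -> 'M[F]_m.+3) (u v : 'cV_m.+3) : preserver T ->
  T (u *m v^h) \in unitmx -> scal ((T (u *m v^h))^h *m T (u *m v^h)).
Proof.
move=> gT uT; have T0 : T 0 \notin unitmx.
  by rewrite (rlin0 (pres_lin gT)) unitr0.
have u0 : u != 0 by apply: contraTneq uT => ->; rewrite mul0mx.
have v0 : v != 0 by apply: contraTneq uT => ->; rewrite ct0 mulmx0.
have [P [r [P1 r0 eu]]] := unitary_column u0.
have [Q [s [Q1 s0 ev]]] := unitary_column v0.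
pose T' X := T (P *m X *m Q^h) *m 1%:M.
have gT' : preserver T'.
  by apply: preserver_mul => //; [apply: unit_mx_ct | apply: unit_mx1].
have e : T (u *m v^h) = inj (r * s) *: T' (delta_mx 0 0).
  have -> : delta_mx 0 0 = (delta_mx 0 0 : 'cV_m.+3) *m delta_mx 0 0 :> 'M[F]_m.+3.
    by rewrite mul_delta_mx.
  rewrite /T' mulmx1 -(rlinZ (pres_lin gT)) eu ev ctZr ctM ct_delta.
  rewrite -scalemxAl -scalemxAr scalerA -rmorphM; congr (T (_ *: _)).
  by rewrite !mulmxA.
have rs0 : inj (r * s) != 0 :> F by rewrite inj_eq0 gt_eqF ?mulr_gt0.
rewrite e ctZr -scalemxAl -scalemxAr; do 2!apply: scalZ; apply: corner_scal => //.
by rewrite e unitmxZ ?unitfE in uT.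
Qed.

Lemma ct_mul_eq0 n p (A : 'M[F]_(n, p)) : A^h *m A = 0 -> A = 0.
Proof.
move=> h; apply/matrixP=> i j; rewrite mxE.
have : col j A = 0.
  apply: nrm_eq0; rewrite /nrm /dot colE ctM -mulmxA (mulmxA A^h) h.
  by rewrite mul0mx mulmx0 mxE re0.
by move/matrixP/(_ i 0); rewrite !mxE.
Qed.

Lemma unit_of_scal n (A : 'M[F]_n) : scal (A^h *m A) -> A != 0 -> A \in unitmx.
Proof.
move=> [r h] A0; have [r0|r0] := eqVneq r 0.
  by rewrite (ct_mul_eq0 (A := A)) ?eqxx // in A0; rewrite h r0 rmorph0 raddf0.
have : (inj r^-1 *: A^h) *m A = 1%:M.
  by rewrite -scalemxAl h scale_scalar_mx -rmorphM mulVf // rmorph1.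
by case/mulmx1_unit.
Qed.

Lemma natF_neq0 k : (k.+1)%:R != 0 :> F.
Proof. by rewrite -(rmorph_nat inj) inj_eq0 pnatr_eq0. Qed.

(** For [t <> 0], [M + t N] is singular only if [-1/t] is an eigenvalue of [M^-1 N]. There are
    finitely many of these, so some [s = 1/(k+1)] works. *)
Lemma perturb_unit n (M N : 'M[F]_n) : M \in unitmx ->
  exists s, [/\ s != 0, M + inj s *: N \in unitmx & M - inj s *: N \in unitmx].
Proof.
move=> uM; pose p := char_poly (invmx M *m N).
have p0 : p != 0 by apply: monic_neq0; apply: char_poly_monic.
(* The roots of [q] are the eigenvalues and their negatives, so avoiding them settles both signs at
   once. *)
pose q := p * (p \Po (- 'X)).
have q0 : q != 0.
  rewrite mulf_neq0 // -size_poly_eq0 size_comp_poly2 ?size_poly_eq0 //.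
  by rewrite size_polyN size_polyX.
pose rs := [seq (k.+1)%:R : F | k <- iota 0 (size q)].
have [k qk] : exists k, ~~ root q (k.+1)%:R.
  apply: contrapT => h.
  have : (size rs < size q)%N.
    apply: max_poly_roots => //; last first.
      rewrite map_inj_uniq ?iota_uniq // => a b.
      by rewrite -!(rmorph_nat inj) => /inj_inj/eqP; rewrite eqr_nat eqSS => /eqP.
    by apply/allP=> _ /mapP[k _ ->]; apply/negPn/negP => hk; apply: h; exists k.
  by rewrite size_map size_iota ltnn.
have key c : c != 0 -> ~~ root p c -> M - c^-1 *: N \in unitmx.
  move=> c0; apply: contraR; rewrite -row_free_unit -kermx_eq0.
  case/rowV0Pn => v /sub_kermxP; rewrite mulmxBr => /eqP; rewrite subr_eq0 => /eqP vM v0.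
  rewrite -eigenvalue_root_char; apply/eigenvalueP; exists (v *m M).
    by rewrite mulmxA mulmxK // vM -scalemxAr scalerA divff // scale1r.
  by apply: contra_neq v0 => h; rewrite -(mulmxK uM v) h mul0mx.
move: qk; rewrite /q rootM negb_or => /andP[k1 k2].
exists (k.+1)%:R^-1; split.
- by rewrite invr_eq0 pnatr_eq0.
- rewrite fmorphV rmorph_nat -[_ *: N]opprK -scaleNr -invrN.
  apply: key; first by rewrite oppr_eq0 natF_neq0.
  by move: k2; rewrite /root horner_comp hornerN hornerX.
- by rewrite fmorphV rmorph_nat; apply: key; rewrite ?natF_neq0.
Qed.

Section Contradiction.
Variables (m : nat) (T : 'M[F]_m.+3 -> 'M[F]_m.+3).
Hypothesis gT : preserver T.

(** With [f(A) = A^h A], the parallelogram identity reads [f(M + s N) + f(M - s N) - 2 f(M) = 2 s^2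
    f(N)]. Because of the common factor [v^h], the matrices [M + s N] and [M - s N] are again images
    of rank one matrices, and they are invertible for a suitable [s]. *)
Lemma rank1_spread (S : 'M[F]_m.+3 -> 'M[F]_m.+3) (u0 v u : 'cV_m.+3) :
  preserver S ->
  S (u0 *m v^h) \in unitmx -> scal ((S (u *m v^h))^h *m S (u *m v^h)).
Proof.
move=> gS uS; have [s [s0 s1 s2]] := perturb_unit (S (u *m v^h)) uS.
have e1 : S (u0 *m v^h) + inj s *: S (u *m v^h) = S ((u0 + inj s *: u) *m v^h).
  by rewrite addrC -(pres_lin gS) addrC mulmxDl -scalemxAl.
have e2 : S (u0 *m v^h) - inj s *: S (u *m v^h) = S ((u0 - inj s *: u) *m v^h).
  by rewrite -(rlinZ (pres_lin gS)) -(rlinB (pres_lin gS)) mulmxBl -scalemxAl.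
have h1 : scal ((S (u0 *m v^h) + inj s *: S (u *m v^h))^h *m
                (S (u0 *m v^h) + inj s *: S (u *m v^h))).
  by rewrite e1; apply: rank1_scal => //; rewrite -e1.
have h2 : scal ((S (u0 *m v^h) - inj s *: S (u *m v^h))^h *m
                (S (u0 *m v^h) - inj s *: S (u *m v^h))).
  by rewrite e2; apply: rank1_scal => //; rewrite -e2.
have h0 := rank1_scal gS uS.
move: h0 h1 h2; move: (S (u0 *m v^h)) (S (u *m v^h)) => M N h0 h1 h2.
have s20 : 2 * s ^+ 2 != 0 by rewrite mulf_neq0 ?pnatr_eq0 ?expf_neq0.
apply: (scalZK s20).
have := scalB (scalD h1 h2) (scalZ 2 h0); congr scal.
rewrite ctD ctB ctZr !(mulmxDl, mulmxDr, mulmxBl, mulmxBr, mulNmx, mulmxN).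
rewrite -!scalemxAl -!scalemxAr expr2 !rmorphM rmorph_nat.
move: (M^h *m M) (M^h *m N) (N^h *m M) (N^h *m N) => a b c d.
by apply/matrixP=> i j; rewrite !mxE; ring.
Qed.

(** First [u0] is changed to [u]; the new image is nonzero with scalar square, hence invertible.
    Then [v0] is changed to [v] by the same argument for [X |-> T X^h]. *)
Lemma rank1_all_scal (u0 v0 u v : 'cV_m.+3) : T (u0 *m v0^h) \in unitmx ->
  scal ((T (u *m v^h))^h *m T (u *m v^h)).
Proof.
move=> h0; have [->|u1] := eqVneq u 0.
  by rewrite mul0mx (rlin0 (pres_lin gT)) mulmx0; apply: scal0.
have v1 : v0 != 0.
  apply: contraTneq h0 => ->.
  by rewrite ct0 mulmx0 (rlin0 (pres_lin gT)) unitr0.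
have h1 : T (u *m v0^h) \in unitmx.
  apply: unit_of_scal; first exact: rank1_spread h0.
  apply/eqP => /(pres_inj gT) /(congr1 (mulmx^~ v0)).
  rewrite mul0mx -mulmxA dotE mul_mx_scalar => /eqP.
  by rewrite scaler_eq0 (negPf u1) orbF (negPf (dot_neq0 v1)).
have := @rank1_spread (fun X => T X^h) v0 u v (preserver_ctr gT).
by rewrite !ctM !ctK; apply.
Qed.

Lemma polar_diag X Y : polar T X Y =
  (T (X + Y))^h *m T (X + Y) - (T X)^h *m T X - (T Y)^h *m T Y.
Proof.
rewrite (rlinD (pres_lin gT)) ctD mulmxDl !mulmxDr /polar.
move: (_ *m _) (_ *m _) (_ *m _) (_ *m _) => a b c d.
by apply/matrixP=> i j; rewrite !mxE; ring.
Qed.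

(** Otherwise all rank one matrices have scalar squares. Pairs of elementary matrices with a common
    factor are then handled by polarization and the others by [polar_scal], so [polar T] is scalar
    everywhere. But surjectivity gives [T X = delta_mx 0 0], and twice this matrix is not scalar. *)
Lemma rank1_singular (u v : 'cV_m.+3) : T (u *m v^h) \notin unitmx.
Proof.
apply/negP => uT; have h u' v' := rank1_all_scal u' v' uT.
have p1 (a b c : 'cV_m.+3) : scal (polar T (a *m c^h) (b *m c^h)).
  by rewrite polar_diag -mulmxDl; apply: scalB; [apply: scalB|]; apply: h.
have p2 (a b c : 'cV_m.+3) : scal (polar T (c *m a^h) (c *m b^h)).
  by rewrite polar_diag -mulmxDr -ctD; apply: scalB; [apply: scalB|]; apply: h.
have lL X := polar_linl (pres_lin gT) X; have lR X := polar_linr (pres_lin gT) X.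
have all X Y : scal (polar T X Y).
  rewrite [X]matrix_sum_delta (rlin_sum (lL _)); apply: scal_sum => i _.
  rewrite (rlin_sum (lL _)); apply: scal_sum => j _.
  rewrite [Y]matrix_sum_delta (rlin_sum (lR _)); apply: scal_sum => k _.
  rewrite (rlin_sum (lR _)); apply: scal_sum => l _.
  rewrite (delta_mul i j) (delta_mul k l); have [->|jl] := eqVneq j l; first exact: p1.
  have [->|ik] := eqVneq i k; last first.
    by apply: polar_scal => //; rewrite ?dotZl ?dotZr dot_delta ?mulr0.
  (* Coefficients move to the right factor, so that both matrices have the same left factor. *)
  have sw c (x y : 'cV[F]_m.+3) : (c *: x) *m y^h = x *m (cj c *: y)^h.
    by rewrite ctZ cjK -scalemxAl -scalemxAr.
  by rewrite !sw; apply: p2.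
have [X hX] := pres_surj gT (delta_mx 0 0).
have [r hr] := all X X; move: hr; rewrite /polar hX ct_delta mul_delta_mx => e.
have := congr1 (fun A : 'M_m.+3 => A 0 0) e.
have := congr1 (fun A : 'M_m.+3 => A (lift 0 0) (lift 0 0)) e.
rewrite /= [LHS]mxE mxE eq_sym (negPf (neq_lift _ _)) addr0 [RHS]mxE eqxx mulr1n => <-.
rewrite [LHS]mxE mxE [RHS]mxE mul0rn eqxx => /eqP.
by rewrite -mulr2n (negPf (natF_neq0 1)).
Qed.

(** A nonzero [x] in the kernel of the singular matrix [T (u *m v^h)] satisfies
    [dot x (polar x) = 0], which forces the scalar to be 0. *)
Lemma polar_zero (u v u' v' : 'cV_m.+3) : dot u u' = 0 -> dot v v' = 0 ->
  polar T (u *m v^h) (u' *m v'^h) = 0.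
Proof.
move=> uu vv; have [r hr] := polar_scal gT uu vv.
have := rank1_singular u v; rewrite -unitmx_tr -row_free_unit -kermx_eq0.
case/rowV0Pn => w /sub_kermxP /(congr1 trmx); rewrite trmx_mul trmxK trmx0 => Mw w0.
set x := w^T in Mw; have x0 : x != 0 by rewrite -(inj_eq trmx_inj) trmxK trmx0.
have : dot x (polar T (u *m v^h) (u' *m v'^h) *m x) = 0.
  rewrite /polar mulmxDl dotDr -[_ *m _ *m x]mulmxA -[_ *m _ *m x]mulmxA.
  rewrite Mw mulmx0 dot0r addr0.
  by rewrite dot_mulr ctK Mw dot0l.
rewrite hr mul_scalar_mx dotZr => /eqP; rewrite mulf_eq0 (negPf (dot_neq0 x0)) orbF.
by move/eqP => ->; rewrite raddf0.
Qed.

End Contradiction.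
End Singular.

(** * The kernels of the maps [X |-> T(X) w] *)

Section Columns.
Variables (R : rcfType) (F : starField R).

Lemma cV_sum_delta n (x : 'cV[F]_n) : x = \sum_i x i 0 *: delta_mx i 0.
Proof.
by rewrite [LHS]matrix_sum_delta; apply: eq_bigr => i _; rewrite big_ord1.
Qed.

Lemma dot_deltaZ n (i : 'I_n) (a b : F) :
  dot (a *: delta_mx i 0 : 'cV[F]_n) (b *: delta_mx i 0) = cj a * b.
Proof.
by rewrite dotZl dotZr /dot ct_delta mul_delta_mx mxE !eqxx mulr1.
Qed.

(** In coordinates the off-diagonal terms vanish, and all diagonal terms come from the single
    functional [c |-> h e_0 (c e_0)], represented by [b]. *)
Lemma orthogonal_form m (h : 'cV[F]_m.+2 -> 'cV[F]_m.+2 -> R) :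
  (forall y, rfun (h ^~ y)) -> (forall x, rfun (h x)) ->
  (forall x y, dot x y = 0 -> h x y = 0) ->
  exists b, forall x y, h x y = re (b * dot x y).
Proof.
move=> hl hr h0; pose e i : 'cV[F]_m.+2 := delta_mx i 0.
have off (i j : 'I_m.+2) (a b : F) : i != j -> h (a *: e i) (b *: e j) = 0.
  by move=> ij; apply: h0; rewrite dotZl dotZr dot_delta // !mulr0.
have swap (i j : 'I_m.+2) (a b : F) :
    i != j -> h (a *: e i) (b *: e i) = h (e j) ((cj a * b) *: e j).
  move=> ij; have ji : j != i by rewrite eq_sym.
  (* The coefficient [- (cj a * b)] makes these two vectors orthogonal. *)
  have := h0 (a *: e i + 1 *: e j) (b *: e i + (- (cj a * b)) *: e j).
  rewrite !dotDr !dotDl !dot_deltaZ rmorph1 mul1r.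
  rewrite !(dotZl, dotZr) !dot_delta // !mulr0 addr0 add0r subrr => /(_ erefl).
  rewrite (rfunD (hl _)) !(rfunD (hr _)) (off i j) // (off j i) //.
  rewrite add0r addr0 scale1r scaleNr.
  have -> : h (e j) (- ((cj a * b) *: e j)) = - h (e j) ((cj a * b) *: e j).
    by apply/eqP; rewrite -addr_eq0 -(rfunD (hr _)) addNr (rfun0 (hr _)).
  by move/eqP; rewrite subr_eq0 => /eqP.
have diag i (a b : F) : h (a *: e i) (b *: e i) = h (e 0) ((cj a * b) *: e 0).
  have [->|i0] := eqVneq i 0; last exact: swap.
  (* For [i = 0] the identity is reached through a second index and back. *)
  rewrite (swap _ (lift 0 0)) ?neq_lift // -[e (lift 0 0)]scale1r.
  by rewrite scalerA mulr1 (swap _ 0) ?rmorph1 ?mul1r // eq_sym neq_lift.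
have [|b hb] := @re_repr R F (fun c => h (e 0) (c *: e 0)).
  by move=> a x y; rewrite scalerDl -scalerA hr.
exists b => x y; rewrite dot_sum mulr_sumr re_sum.
rewrite {1}[x]cV_sum_delta (rfun_sum (hl _)); apply: eq_bigr => i _.
rewrite {1}[y]cV_sum_delta (rfun_sum (hr _)) (bigD1 i) //= big1 ?addr0.
  by rewrite diag hb.
by move=> j ji; apply: off; rewrite eq_sym.
Qed.

Lemma riesz n (f : 'cV[F]_n -> R) : rfun f -> exists y, forall x, f x = re (dot y x).
Proof.
move=> lf.
have /choice[b hb] : forall i : 'I_n,
    exists b : F, forall c, f (c *: delta_mx i 0) = re (b * c).
  by move=> i; apply: re_repr => a x y; rewrite scalerDl -scalerA lf.
exists (\col_i cj (b i)) => x.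
rewrite dot_sum re_sum {1}[x]cV_sum_delta (rfun_sum lf).
by apply: eq_bigr => i _; rewrite hb mxE cjK.
Qed.

(** The other kind of kernel, [{X | y^h X = 0}], is this property for [X |-> T X^h]. *)
Definition column_type n (T : 'M[F]_n -> 'M[F]_n) (w : 'cV[F]_n) :=
  exists y : 'cV[F]_n, forall X, T X *m w = 0 <-> X *m y = 0.

Section Rank1Action.
Variables (m : nat) (T : 'M[F]_m.+3 -> 'M[F]_m.+3) (w : 'cV[F]_m.+3).
Hypothesis lT : rlin T.
Implicit Types u v x y z : 'cV[F]_m.+3.

Let phi u v := T (u *m v^h) *m w.
Let g u v u' v' := re (dot (phi u v) (phi u' v')).

Let phil v : rlin (phi ^~ v).
Proof.
by move=> a x y; rewrite /phi mulmxDl -scalemxAl lT mulmxDl -scalemxAl.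
Qed.
Let phir u : rlin (phi u).
Proof.
by move=> a x y; rewrite /phi rlin_ct mulmxDr -scalemxAr lT mulmxDl -scalemxAl.
Qed.
Let phiZ c u v : phi (c *: u) v = phi u (cj c *: v).
Proof. by rewrite /phi ctZ cjK -scalemxAl -scalemxAr. Qed.

Let re_dot_lin (x : 'cV[F]_m.+3) : rfun (fun y => re (dot x y)).
Proof. by move=> a y z; rewrite dotDr dotZr reD reZ. Qed.
Let re_dot_linl (x : 'cV[F]_m.+3) : rfun (fun y => re (dot y x)).
Proof. by move=> a y z; rewrite dotDl dotZl cj_inj reD reZ. Qed.

Let g1 v u' v' : rfun (fun u => g u v u' v').
Proof. by move=> a x y; rewrite /g phil re_dot_linl. Qed.
Let g2 u u' v' : rfun (fun v => g u v u' v').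
Proof. by move=> a x y; rewrite /g phir re_dot_linl. Qed.
Let g3 u v v' : rfun (fun u' => g u v u' v').
Proof. by move=> a x y; rewrite /g phil re_dot_lin. Qed.
Let g4 u v u' : rfun (fun v' => g u v u' v').
Proof. by move=> a x y; rewrite /g phir re_dot_lin. Qed.

Let form_injective v v' b : b != 0 -> (forall u u', g u v u' v' = re (b * dot u u')) ->
  forall u, phi u v = 0 -> u = 0.
Proof.
move=> b0 hb u pu; apply/eqP/negPn/negP => u0.
have : b * dot u u = 0.
  apply: re_eq0 => c; rewrite mulrC -mulrA [_ * c]mulrC -dotZr -hb.
  by rewrite /g pu dot0l re0.
by move/eqP; rewrite mulf_eq0 (negPf b0) (negPf (dot_neq0 u0)).
Qed.

(** Evaluation at [e_0] gives [b = 0]. So [phi u z] is orthogonal to the image of the injective map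
    [phi ^~ v], and [injective_dense] applies. *)
Let form_kernel v z b : (forall u, phi u v = 0 -> u = 0) ->
  (forall u u', g u v u' z = re (b * dot u u')) ->
  (forall c : F, g (delta_mx 0 0) v (delta_mx 0 0) (c *: z) = 0) ->
  forall u, phi u z = 0.
Proof.
move=> iv hb hc u; have b0 : b = 0.
  apply: re_eq0 => c; have := hc (cj c); rewrite /g -phiZ => h.
  have := hb (delta_mx 0 0) (c *: delta_mx 0 0); rewrite /g h.
  by rewrite -[X in dot X]scale1r dot_deltaZ rmorph1 mul1r mulrC.
apply: (injective_dense (phil v) iv) => u'.
by have := hb u' u; rewrite b0 mul0r re0.
Qed.

(** If the second alternative fails, some [phi ^~ v] is injective, and a count yields [z <> 0] with
    [phi u z = 0] for all [u]. For orthogonal [u], [u'] the form in [v], [v'] is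
    [re (c * dot v v')], and evaluation at [z] gives [c = 0]. *)
Lemma rank1_dichotomy :
  (forall u v u' v', dot u u' = 0 -> dot v v' = 0 -> g u v u' v' = 0) ->
  (forall u u', dot u u' = 0 -> forall v v', g u v u' v' = 0) \/
  (forall v v', dot v v' = 0 -> forall u u', g u v u' v' = 0).
Proof.
move=> g0.
have formv v v' : dot v v' = 0 -> exists b, forall u u', g u v u' v' = re (b * dot u u').
  by move=> vv; apply: orthogonal_form => // x y xy; apply: g0.
have [[v [v' [vv [u1 [u1' g1']]]]]|none] :=
  pselect (exists v v', dot v v' = 0 /\ exists u u', g u v u' v' <> 0); last first.
  right=> v v' vv u u'; apply: contrapT => h; apply: none.
  by exists v, v'; split=> //; exists u, u'.
left; have [b hb] := formv _ _ vv.
have b0 : b != 0 by apply/eqP => b0; apply: g1'; rewrite hb b0 mul0r re0.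
have iv := form_injective b0 hb.
have [z z0 hz] : exists2 z : 'cV[F]_m.+3, z != 0 & dot v z = 0 /\
    forall c : F, g (delta_mx 0 0) v (delta_mx 0 0) (c *: z) = 0.
  (* With [d] the real dimension of [F], the two conditions on [z] cost [2 d] real equations, fewer
     than the [n d] unknowns since [n >= 3]. *)
  pose J := ('I_(dim F).+1 + 'I_(dim F).+1)%type.
  pose f (t : J) z := match t with inl k => coord k (dot v z)
    | inr k => g (delta_mx 0 0) v (delta_mx 0 0) (vec k *: z) end.
  have [||z z0 hz] := @solve_real_system R F m.+3 1 J f.
  - case=> k a x y; rewrite /f; first by rewrite dotDr dotZr coord_lin.
    by rewrite scalerDr !scalerA [_ * inj a]mulrC -scalerA g4.
  - by rewrite card_sum !card_ord; nia.
  exists z => //; split; first by apply: coord_eq0 => k; apply: (hz (inl k)).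
  move=> c; rewrite (coord_span c) scaler_suml (rfun_sum (g4 _ _ _)) big1 // => k _.
  rewrite -scalerA (rfunZ (g4 _ _ _)); have := hz (inr k); rewrite /f => ->.
  by rewrite mulr0.
case: hz => vz hz; have [bz hbz] := formv _ _ vz.
have phiz := form_kernel iv hbz hz.
move=> u u' uu; have [|||c hc] := @orthogonal_form m.+1 (fun v v' => g u v u' v').
- by move=> y; apply: g2.
- by move=> x; apply: g4.
- by move=> x y xy; apply: g0.
have c0 : c = 0.
  have : c * dot z z = 0.
    apply: re_eq0 => a; rewrite mulrC -mulrA [_ * a]mulrC -dotZr -hc.
    by rewrite /g phiz dot0l re0.
  by move/eqP; rewrite mulf_eq0 (negPf (dot_neq0 z0)) orbF => /eqP.
by move=> x y; rewrite hc c0 mul0r re0.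
Qed.

(** Choose [v0] with [phi ^~ v0] nonzero, hence injective. The vector [y] represents
    [z |-> g e_0 v0 e_0 z]; then [dot y z = 0] forces [phi u z = 0] for all [u], which is applied to
    each row of [X]. *)
Lemma column_type_of_orth : (exists X, T X *m w != 0) ->
  (forall u u', dot u u' = 0 -> forall v v', g u v u' v' = 0) -> column_type T w.
Proof.
move=> [X0 X0w] P1.
have form v v' : exists b, forall u u', g u v u' v' = re (b * dot u u').
  by apply: orthogonal_form => // x y xy; apply: P1.
have rows X : T X *m w = \sum_i phi (delta_mx i 0) (row i X)^h.
  rewrite /phi -mulmx_suml -(rlin_sum lT); congr (T _ *m w).
  apply/row_matrixP => i; rewrite linear_sum /= (bigD1 i) //= big1 ?addr0.
    rewrite ctK row_mul [row i (delta_mx _ _)]rowE mul_delta_mx.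
    rewrite [delta_mx _ _](_ : _ = 1%:M) ?mul1mx //.
    by apply/matrixP => ? ?; rewrite !mxE !ord1.
  move=> j ji; rewrite ctK row_mul [row i (delta_mx _ _)]rowE.
  by rewrite mul_delta_mx_0 ?mul0mx // eq_sym.
have [v0 [u0 p0]] : exists v0 u0, phi u0 v0 <> 0.
  apply: contrapT => h; case/eqP: X0w; rewrite rows big1 // => i _.
  by apply: contrapT => h'; apply: h; do 2 eexists; exact: h'.
have [b hb] := form v0 v0.
have b0 : b != 0.
  apply/eqP => b0; apply/p0/nrm_eq0; have := hb u0 u0.
  by rewrite b0 mul0r re0.
have iv := form_injective b0 hb.
have [y hy] := riesz (g4 (delta_mx 0 0) v0 (delta_mx 0 0)).
have ker z : dot y z = 0 -> forall u, phi u z = 0.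
  move=> yz; have [bz hbz] := form v0 z; apply: (form_kernel iv hbz) => c.
  by rewrite hy dotZr yz mulr0 re0.
have kerX X : X *m y = 0 -> T X *m w = 0.
  move=> Xy; rewrite rows big1 // => i _; apply: ker.
  by rewrite dotC /dot ctK -row_mul Xy row0 mxE rmorph0.
exists y => X; split=> [Xw|]; last exact: kerX.
have v0y : dot v0 y != 0.
  apply/eqP => h; apply/p0/ker.
  by rewrite dotC h rmorph0.
(* Subtracting the matching rank one matrix from [X] leaves a matrix that kills [y], so the image of
   that rank one matrix also kills [w]. *)
have : phi ((dot v0 y)^-1 *: (X *m y)) v0 = 0.
  have : T (X - (dot v0 y)^-1 *: (X *m y) *m v0^h) *m w = 0.
    apply: kerX; rewrite mulmxBl -[_ *m v0^h *m y]mulmxA dotE mul_mx_scalar scalerA.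
    by rewrite divff // scale1r subrr.
  by rewrite (rlinB lT) mulmxBl Xw sub0r => /eqP; rewrite oppr_eq0 => /eqP.
by move/iv/eqP; rewrite scaler_eq0 invr_eq0 (negPf v0y) => /eqP.
Qed.

End Rank1Action.

(** Testing [polar_zero] against [w] gives the orthogonality needed in [rank1_dichotomy]. *)
Lemma column_or_row m (T : 'M[F]_m.+3 -> 'M[F]_m.+3) w : preserver T -> w != 0 ->
  column_type T w \/ column_type (fun X => T X^h) w.
Proof.
move=> gT w0.
have [X Xw] : exists X, T X *m w != 0.
  by have [X hX] := pres_surj gT 1%:M; exists X; rewrite hX mul1mx.
have lT := pres_lin gT.
have g0 u v u' v' : dot u u' = 0 -> dot v v' = 0 ->
    re (dot (T (u *m v^h) *m w) (T (u' *m v'^h) *m w)) = 0.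
  move=> uu vv; have := polar_zero gT uu vv; rewrite /polar.
  move=> /(congr1 (fun A => re (dot w (A *m w)))).
  have E (A B : 'M_m.+3) : dot w (A^h *m B *m w) = dot (A *m w) (B *m w).
    by rewrite -mulmxA dot_mulr ctK.
  rewrite mul0mx dot0r re0 mulmxDl dotDr reD !E.
  rewrite [X in _ + X]re_dotC => /eqP.
  by rewrite -mulr2n mulrn_eq0 /= => /eqP.
have [P1|P2] := rank1_dichotomy lT g0.
  by left; apply: column_type_of_orth P1 => //; exists X.
right; apply: column_type_of_orth.
- exact: pres_lin (preserver_ctr gT).
- by exists X^h; rewrite ctK.
- by move=> u u' uu v v'; rewrite !ctM !ctK; apply: P2.
Qed.

End Columns.

(** * The standard forms *)

Section StandardForm.
Variables (R : rcfType) (F : starField R).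

(** With [p] the component of [w'] orthogonal to [w], the matrix is [a p^h / |p|^2]. *)
Lemma separating_mx n (w w' a : 'cV[F]_n) : w != 0 -> (forall c, w' <> c *: w) ->
  exists A : 'M[F]_n, A *m w = 0 /\ A *m w' = a.
Proof.
move=> w0 ww'; pose p := w' - (dot w w' / dot w w) *: w.
have pw : dot p w = 0.
  by rewrite dotC dotBr dotZr divfK ?subrr ?rmorph0 // dot_neq0.
have p0 : p != 0 by rewrite subr_eq0; apply/eqP; apply: ww'.
have pw' : dot p w' = dot p p by rewrite {3}/p dotBr dotZr pw mulr0 subr0.
exists ((dot p p)^-1 *: a *m p^h); rewrite -!mulmxA !dotE pw pw'.
split; first by rewrite raddf0 mulmx0.
by rewrite mul_mx_scalar scalerA divff ?scale1r // dot_neq0.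
Qed.

Lemma dual_vector n (y y0 : 'cV[F]_n) : (forall c, y0 <> c *: y) ->
  exists p, dot p y = 0 /\ dot p y0 = 1.
Proof.
move=> h; have y00 : y0 != 0 by apply/eqP => e; apply: (h 0); rewrite scale0r.
have [->|yn0] := eqVneq y 0.
  exists (inj (nrm y0)^-1 *: y0); rewrite dot0r dotZl cj_inj nrmE -rmorphM.
  by rewrite mulVf ?rmorph1 // gt_eqF ?nrm_gt0.
have [A [Ay Ay0]] := separating_mx y0 yn0 h.
exists (inj (nrm y0)^-1 *: (A^h *m y0)).
rewrite !dotZl !dot_mull !ctK Ay Ay0 dot0r mulr0 cj_inj nrmE -rmorphM.
by rewrite mulVf ?rmorph1 // gt_eqF ?nrm_gt0.
Qed.

Section FixedMap.
Variables (m : nat) (T : 'M[F]_m.+3 -> 'M[F]_m.+3).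
Hypothesis gT : preserver T.
Implicit Types w x y : 'cV[F]_m.+3.

Let lT := pres_lin gT.

Lemma column_vector_neq0 w y : w != 0 ->
  (forall X, T X *m w = 0 <-> X *m y = 0) -> y != 0.
Proof.
move=> w0 h; apply/eqP=> y0; have [X hX] := pres_surj gT 1%:M.
by case/eqP: w0; rewrite -[w]mul1mx -hX; apply/h; rewrite y0 mulmx0.
Qed.

(** As [T X] can be prescribed on both [w] and [w'], there is [X] with [X y = y'] and [X^h y' = 0].
    Then [|y'|^2 = dot y' (X y) = dot (X^h y') y = 0], which is impossible. *)
Lemma column_row_exclusive w w' : w != 0 -> w' != 0 -> (forall c, w <> c *: w') ->
  column_type T w -> column_type (fun X => T X^h) w' -> False.
Proof.
move=> w0 w'0 ww' [y hy] [y' hy'].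
have y0 := column_vector_neq0 w0 hy.
pose X1 := inj (nrm y)^-1 *: (y' *m y^h).
have X1y : X1 *m y = y'.
  rewrite -scalemxAl -mulmxA dotE nrmE mul_mx_scalar scalerA -rmorphM.
  by rewrite mulVf ?rmorph1 ?scale1r // gt_eqF ?nrm_gt0.
have [A [Aw' Aw]] := separating_mx (T X1 *m w) w'0 ww'.
have [X hX] := pres_surj gT A.
have Xy : X *m y = y'.
  apply/eqP; rewrite -X1y -subr_eq0 -mulmxBl; apply/eqP/hy.
  by rewrite (rlinB lT) mulmxBl hX Aw subrr.
have Xy' : X^h *m y' = 0 by apply/hy'; rewrite ctK hX.
have /nrm_eq0 y'0 : nrm y' = 0.
  by rewrite /nrm -{2}Xy dot_mulr Xy' dot0l re0.
have [Z hZ] := pres_surj gT 1%:M.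
by case/eqP: w'0; rewrite -[w']mul1mx -hZ -[Z]ctK; apply/hy'; rewrite y'0 mulmx0.
Qed.

Lemma column_type_scale w c : c != 0 -> column_type T w -> column_type T (c *: w).
Proof.
move=> c0 [y hy]; exists y => X; rewrite -hy -scalemxAr; split=> [/eqP|->].
  by rewrite scaler_eq0 (negPf c0) => /eqP.
by rewrite scaler0.
Qed.

Lemma all_column_type w0 : w0 != 0 -> column_type T w0 ->
  forall w, w != 0 -> column_type T w.
Proof.
move=> w00 h0 w wn0; have [//|h] := column_or_row gT wn0.
have [[c wc]|nc] := pselect (exists c, w0 = c *: w); last first.
  by case: (column_row_exclusive w00 wn0 _ h0 h) => c wc; apply: nc; exists c.
have c0 : c != 0 by apply: contra_neq w00 => c0; rewrite wc c0 scale0r.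
have -> : w = c^-1 *: w0 by rewrite wc scalerA mulVf ?scale1r.
by apply: column_type_scale; rewrite ?invr_eq0.
Qed.

Let e (i : 'I_m.+3) : 'cV[F]_m.+3 := delta_mx i 0.

Lemma delta_neq0 (i : 'I_m.+3) : e i != 0.
Proof. by apply/eqP=> /matrixP/(_ i 0)/eqP; rewrite !mxE !eqxx oner_eq0. Qed.

Lemma delta_indep (i j : 'I_m.+3) c : i != j -> e i <> c *: e j.
Proof.
move=> ij /matrixP/(_ i 0)/eqP.
by rewrite !mxE !eqxx (negPf ij) mulr0 oner_eq0.
Qed.

Lemma factor_form : (forall w, w != 0 -> column_type T w) ->
  exists A B, (forall X, T X = A *m X *m B) \/
              (forall X, T X = A *m map_mx cj X *m B).
Proof.
move=> hcol.
have /choice[y hy] : forall i, exists y, forall X, T X *m e i = 0 <-> X *m y = 0.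
  by move=> i; apply: hcol; apply: delta_neq0.
have y0 i : y i != 0 by apply: column_vector_neq0 (hy i); apply: delta_neq0.
(* The value of [T X *m e i] depends only on [X *m y i]; dividing by [|y_i|^2] gives a rank one [X]
   with [X *m y i = x]. *)
pose psi i x := T (x *m (inj (nrm (y i))^-1 *: y i)^h) *m e i.
have psiD i : rlin (psi i).
  by move=> a u v; rewrite /psi mulmxDl -scalemxAl lT mulmxDl -scalemxAl.
have nrmV i x : x *m (inj (nrm (y i))^-1 *: y i)^h *m y i = x.
  rewrite -mulmxA dotE dotZl cj_inj nrmE -rmorphM mulVf ?rmorph1 ?mulmx1 //.
  by rewrite gt_eqF ?nrm_gt0.
have psiE i X : T X *m e i = psi i (X *m y i).
  apply/eqP; rewrite /psi -subr_eq0 -mulmxBl -(rlinB lT); apply/eqP/hy.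
  by rewrite mulmxBl nrmV subrr.
have psi_inj i x : psi i x = 0 -> x = 0 by move/hy; rewrite nrmV.
have rel i l : i != 0 -> l != 0 -> exists k, forall x, psi 0 x = l *: psi i (k *: x).
  move=> i0 l0; pose w := e 0 + l *: e i.
  have w0 : w != 0.
    apply/eqP => /eqP; rewrite addr_eq0 -scaleNr => /eqP.
    by apply: delta_indep; rewrite eq_sym.
  have [z hz] := hcol w w0.
  (* If [y 0] were a multiple of [z], then [T X w = 0] would imply [T X e_0 = 0], against
     surjectivity. *)
  have [c yz|p [pz py]] := @dual_vector _ z (y 0).
    have [|A [Aw A0]] := @separating_mx _ w (e 0) (e 0) w0.
      move=> d; rewrite /w => /matrixP h.
      have := h i 0; have := h 0 0; rewrite !mxE !eqxx (negPf i0) eq_sym (negPf i0) /=.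
      rewrite mulr0 addr0 mulr1 => <-; rewrite mul1r add0r mulr1 => /esym/eqP.
      by rewrite (negPf l0).
    have [X hX] := pres_surj gT A.
    have : e 0 = 0.
      rewrite -A0 -hX; apply/hy; rewrite yz -scalemxAr.
      by have /hz -> : T X *m w = 0; rewrite ?scaler0 // hX.
    by apply/eqP/delta_neq0.
  (* For [X = x p^h] one has [X z = 0] and [X y_0 = x], so [T X w = 0] reads
     [psi 0 x + l psi i (dot p (y i) x) = 0]. *)
  exists (- dot p (y i)) => x.
  have /hz : x *m p^h *m z = 0 by rewrite -mulmxA dotE pz raddf0 mulmx0.
  rewrite /w mulmxDr -scalemxAr !psiE -!mulmxA !dotE py mulmx1 mul_mx_scalar.
  by rewrite scaleNr (rlinN (psiD _)) scalerN => /eqP; rewrite addr_eq0 => /eqP.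
have kne0 i l k : (forall x, psi 0 x = l *: psi i (k *: x)) -> k != 0.
  move=> h; apply/eqP => k0; have := h (e 0); rewrite k0 scale0r (rlin0 (psiD _)) scaler0.
  by move/psi_inj/eqP; rewrite (negPf (delta_neq0 _)).
have /choice[z hz] : forall i, exists z, forall X, T X *m e i = psi 0 (X *m z).
  move=> i; have [->|i0] := eqVneq i 0; first by exists (y 0).
  have [k hk] := rel i 1 i0 (oner_neq0 _); have k0 := kne0 _ _ _ hk.
  exists (k^-1 *: y i) => X.
  by rewrite hk scale1r -scalemxAr scalerA divff // scale1r.
(* Comparing [rel] at [1] and at [l^-1] lets scalars pass through [psi 0]. The resulting [mu] is a
   ring endomorphism fixing the reals, hence the identity or [cj]. *)
have /choice[mu hmu] : forall l : F, exists k, forall x, l *: psi 0 x = psi 0 (k *: x).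
  move=> l; have [->|l0] := eqVneq l 0.
    by exists 0 => x; rewrite !scale0r (rlin0 (psiD _)).
  have i0 : lift 0 0 != 0 :> 'I_m.+3 by rewrite eq_sym neq_lift.
  have [k hk] := rel _ _ i0 (oner_neq0 _); have k0 := kne0 _ _ _ hk.
  have lV0 : l^-1 != 0 by rewrite invr_eq0.
  have [k' hk'] := rel _ _ i0 lV0.
  exists (k^-1 * k') => x; rewrite hk' scalerA divff // scale1r.
  by rewrite [RHS]hk scale1r scalerA mulrA divff // mul1r.
have mu_inj a b : (forall x, psi 0 (a *: x) = psi 0 (b *: x)) -> a = b.
  move=> /(_ (e 0)) /eqP; rewrite -subr_eq0 -(rlinB (psiD _)) -scalerBl => /eqP.
  by move/psi_inj/eqP; rewrite scaler_eq0 (negPf (delta_neq0 _)) orbF subr_eq0 => /eqP.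
(* Here [psi 0] is [s]-semilinear, so it is [A] applied to the [s]-image of its argument, and [B] is
   the [s]-image of the matrix with columns [z j]. *)
have fin (s : {rmorphism F -> F}) : involutive s -> mu =1 s ->
    exists A B, forall X, T X = A *m map_mx s X *m B.
  move=> sK hs; pose A := \matrix_(i, j) psi 0 (e j) i 0.
  have psiA x : psi 0 x = A *m map_mx s x.
    rewrite {1}[x]cV_sum_delta (rlin_sum (psiD _)).
    transitivity (\sum_i s (x i 0) *: psi 0 (e i)).
      by apply: eq_bigr => i _; rewrite hmu hs sK.
    apply/matrixP=> i j; rewrite ord1 summxE mxE; apply: eq_bigr => k _.
    by rewrite !mxE mulrC.
  exists A, (map_mx s (\matrix_(i, j) z j i 0)) => X.
  apply/matrixP=> i j.
  have := congr1 (fun v : 'cV_m.+3 => v i 0) (hz j X).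
  rewrite -colE mxE => ->; rewrite psiA -mulmxA -map_mxM.
  have -> : X *m z j = col j (X *m \matrix_(i, j) z j i 0).
    rewrite colE -mulmxA -colE; congr (_ *m _).
    by apply/matrixP=> a b; rewrite ord1 !mxE.
  by rewrite map_col colE mulmxA -colE mxE.
have muD : {morph mu : a b / a + b}.
  move=> a b; apply: mu_inj => x; rewrite -hmu [in RHS]scalerDl (rlinD (psiD _)).
  by rewrite scalerDl !hmu.
have muM : {morph mu : a b / a * b}.
  by move=> a b; apply: mu_inj => x; rewrite -hmu -!scalerA -!hmu scalerA.
have muR a : mu (inj a) = inj a.
  by apply: mu_inj => x; rewrite -hmu (rlinZ (psiD _)).
have [hid|hcj] := real_endo muD muM muR.
  have [|A [B h]] := fin idfun _ hid; first by [].
  by exists A, B; left=> X; rewrite h map_mx_id.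
have [|A [B h]] := fin cj _ hcj; first exact: cjK.
by exists A, B; right.
Qed.

End FixedMap.

(** * The two factors are multiples of unitary matrices *)

Lemma trace_ctl n (A : 'M[F]_n) : \tr (A^h *m A) = inj (\sum_j nrm (col j A)).
Proof.
rewrite rmorph_sum /mxtrace; apply: eq_bigr => j _.
rewrite -nrmE dot_sum mxE; apply: eq_bigr => i _.
by rewrite ctE !mxE.
Qed.

Lemma trace_ctl_neq0 n (A : 'M[F]_n.+1) : A \in unitmx -> \tr (A^h *m A) != 0.
Proof.
move=> uA; rewrite trace_ctl inj_eq0 psumr_eq0 => [|i _]; last exact: nrm_ge0.
apply/negP => /allP h; have : A = 0.
  apply/matrixP=> i j; have /nrm_eq0 : nrm (col j A) = 0.
    by apply/eqP/(implyP (h j _)) => //; rewrite mem_index_enum.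
  by move/matrixP/(_ i 0); rewrite !mxE.
by move=> A0; rewrite A0 unitr0 in uA.
Qed.

Lemma unit_rescale n (A : 'M[F]_n.+1) : A \in unitmx -> scal (A^h *m A) ->
  exists r U, [/\ unit_mx U, 0 < r & A = inj r *: U].
Proof.
move=> uA [a ha]; have a0 : 0 < a.
  have := trace_ctl_neq0 uA.
  rewrite lt_def andbC ha mxtrace_scalar; case: (eqVneq a 0) => [->|_ _].
    by rewrite rmorph0 mul0rn eqxx.
  rewrite andbT; have /matrixP/(_ 0 0) := ha.
  rewrite [RHS]mxE eqxx mulr1n mxE => /(congr1 (@re R F)); rewrite re_inj => <-.
  by rewrite re_sum sumr_ge0 // => i _; rewrite ctE norm_ge0.
have s0 : 0 < Num.sqrt a by rewrite sqrtr_gt0.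
exists (Num.sqrt a), (inj (Num.sqrt a)^-1 *: A); split=> //.
  rewrite /unit_mx ctZr -scalemxAl -scalemxAr ha !scale_scalar_mx -!rmorphM.
  rewrite -{3}(sqr_sqrtr (ltW a0)) expr2 mulKf ?gt_eqF // mulVf ?gt_eqF //.
  by rewrite rmorph1.
by rewrite scalerA -rmorphM divff ?gt_eqF // rmorph1 scale1r.
Qed.

(** Cancelling [B] gives [Y^h H Y = s L] with [L] independent of [Y]. Comparing traces gives
    [Y^h H Y = H], so [H] commutes with every unitary matrix. Commuting with the reflection along
    [x] makes [x] an eigenvector. *)
Lemma scal_of_factor n (A B : 'M[F]_n.+1) : A \in unitmx -> B \in unitmx ->
  (forall Y, unit_mx Y -> scal ((A *m Y *m B)^h *m (A *m Y *m B))) -> scal (A^h *m A).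
Proof.
move=> uA uB h; set H := A^h *m A.
have uBh : B^h \in unitmx by rewrite unitmx_tr map_unitmx.
pose L := invmx B^h *m invmx B.
have hY Y : unit_mx Y -> exists s, Y^h *m H *m Y = inj s *: L.
  move=> /h [s hs]; exists s.
  rewrite /L scalemxAl -mul_mx_scalar -hs !ctM -!mulmxA mulKmx // mulmxV // mulmx1.
  by rewrite !mulmxA.
have [s1 h1] := hY _ (unit_mx1 F n.+1).
rewrite ct1 mul1mx mulmx1 in h1.
have trH := trace_ctl_neq0 uA.
have inv Y : unit_mx Y -> Y^h *m H *m Y = H.
  move=> Y1; have [s hs] := hY _ Y1.
  have : \tr (Y^h *m H *m Y) = \tr H.
    by rewrite mxtrace_mulC mulmxA (unit_mxC Y1) mul1mx.
  rewrite hs {1}h1 !mxtraceZ => /eqP; rewrite -subr_eq0 -mulrBl mulf_eq0.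
  have -> : \tr L == 0 = false.
    by apply: contraNF trH => /eqP l0; rewrite -/H h1 mxtraceZ l0 mulr0.
  by rewrite orbF subr_eq0 => /eqP ->.
have comm Y : unit_mx Y -> H *m Y = Y *m H.
  by move=> Y1; rewrite -[in RHS](inv _ Y1) !mulmxA (unit_mxC Y1) mul1mx.
apply: scal_line; first by rewrite ctM ctK.
move=> x; have [->|x0] := eqVneq x 0; first by exists 0; rewrite mulmx0 scaler0.
exists (inj (nrm x)^-1 * dot x (H *m x)).
have := comm _ (unit_reflection x0); rewrite mulmxBr mulmxBl mulmx1 mul1mx.
move/addrI/oppr_inj; rewrite -scalemxAl -scalemxAr => /scalerI e.
have c0 : inj (2 / nrm x) != 0 :> F.
  by rewrite inj_eq0 gt_eqF // divr_gt0 ?ltr0Sn ?nrm_gt0.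
have {e c0} := congr1 (mulmx^~ x) (e c0).
rewrite -!mulmxA dotE nrmE mul_mx_scalar -scalemxAr dotE mul_mx_scalar => e.
rewrite -scalerA -e -scalemxAr scalerA -rmorphM mulVf ?rmorph1 ?scale1r //.
by rewrite gt_eqF ?nrm_gt0.
Qed.

(* [tau] is one of the identity, the transpose, the entrywise conjugation and
   the conjugate transpose. *)
Lemma standard_of_factor n (T tau : 'M[F]_n.+1 -> 'M[F]_n.+1) A B :
  preserver T -> involutive tau -> (forall Y, unit_mx Y -> unit_mx (tau Y)) ->
  (forall X, T X = A *m tau X *m B) ->
  exists U V r, [/\ unit_mx U, unit_mx V, 0 < r &
    forall X, T X = inj r *: (U *m tau X *m V)].
Proof.
move=> gT tauK utau hT.
have [X hX] := pres_surj gT 1%:M; rewrite hT -mulmxA in hX.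
have [uA _] := mulmx1_unit hX.
have [_ uB] : A *m tau X \in unitmx /\ B \in unitmx.
  by apply: mulmx1_unit; rewrite -mulmxA.
have sA : scal (A^h *m A).
  apply: (scal_of_factor uA uB) => Y Y1; rewrite -[Y]tauK -hT.
  by apply: (pres_ctl gT); apply: utau.
have uAh : A^h \in unitmx by rewrite unitmx_tr map_unitmx.
have uBh : B^h \in unitmx by rewrite unitmx_tr map_unitmx.
(* For the adjoint of [T] the factors [A] and [B] exchange roles. *)
have sB : scal (B^h^h *m B^h).
  apply: (scal_of_factor uBh uAh) => Y Y1.
  have -> : B^h *m Y *m A^h = (T (tau Y^h))^h by rewrite hT tauK !ctM ctK mulmxA.
  by rewrite ctK; apply: (pres_ctr gT); apply/utau/unit_mx_ct.
have [a [U [U1 a0 eA]]] := unit_rescale uA sA.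
have [b [V [V1 b0 eB]]] := unit_rescale uBh sB.
exists U, V^h, (a * b); split; rewrite ?mulr_gt0 //; first exact: unit_mx_ct.
move=> X'; rewrite hT -[B]ctK eB eA ctZr -!scalemxAl -!scalemxAr scalerA.
by rewrite -rmorphM.
Qed.

Definition standard_form n (T : 'M[F]_n -> 'M[F]_n) :=
  exists U V r, [/\ unit_mx U, unit_mx V, 0 < r &
    [\/ (forall X, T X = inj r *: (U *m X *m V)),
        (forall X, T X = inj r *: (U *m X^T *m V)),
        (forall X, T X = inj r *: (U *m map_mx cj X *m V)) |
        (forall X, T X = inj r *: (U *m (map_mx cj X)^T *m V))]].

Lemma map_cjK n : involutive (map_mx cj : 'M[F]_n -> 'M[F]_n).
Proof. by move=> X; apply/matrixP=> i j; rewrite !mxE cjK. Qed.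

Lemma unit_mx_map n (Y : 'M[F]_n) : unit_mx Y -> unit_mx (map_mx cj Y).
Proof.
by rewrite /unit_mx => h; rewrite -(map_mx1 cj) -h map_mxM /ct map_trmx.
Qed.

Lemma unit_mx_tr n (Y : 'M[F]_n) : unit_mx Y -> unit_mx Y^T.
Proof.
by move=> /unit_mx_ct/unit_mx_map; rewrite /ct map_trmx map_cjK.
Qed.

(** The row case is the column case for [X |-> T X^h]; its linear form yields the conjugate
    transpose and its conjugate linear form the transpose. *)
Theorem preserver_standard m (T : 'M[F]_m.+3 -> 'M[F]_m.+3) :
  preserver T -> standard_form T.
Proof.
move=> gT; have e0 := delta_neq0 (0 : 'I_m.+3).
have [h|h] := column_or_row gT e0.
  have [A [B [hAB|hAB]]] := factor_form gT (all_column_type gT e0 h).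
    have [//|//|U [V [r [? ? ? ?]]]] := standard_of_factor (tau := id) gT _ _ hAB.
    by exists U, V, r; split=> //; constructor 1.
  have [||U [V [r [? ? ? ?]]]] := standard_of_factor (tau := map_mx cj) gT _ _ hAB.
  - exact: map_cjK.
  - exact: unit_mx_map.
  by exists U, V, r; split=> //; constructor 3.
have gT' := preserver_ctr gT.
have [A [B [hAB|hAB]]] := factor_form gT' (all_column_type gT' e0 h).
  have hT X : T X = A *m X^h *m B by rewrite -hAB ctK.
  have [||U [V [r [? ? ? ?]]]] := standard_of_factor (tau := @ct R F _ _) gT _ _ hT.
  - exact: ctK.
  - exact: unit_mx_ct.
  by exists U, V, r; split=> //; constructor 4.
have hT X : T X = A *m X^T *m B.
  by rewrite -[X in T X]ctK hAB /ct map_trmx map_cjK.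
have [||U [V [r [? ? ? ?]]]] := standard_of_factor (tau := trmx) gT _ _ hT.
- exact: trmxK.
- exact: unit_mx_tr.
by exists U, V, r; split=> //; constructor 2.
Qed.

End StandardForm.

(** * The equivalence in the common setting *)

Section Equivalence.
Variables (R : rcfType) (F : starField R).

Lemma preserver_of_bijective n (T : 'M[F]_n -> 'M[F]_n) : rlin T -> bijective T ->
  (forall X, unit_mx X -> exists g U, unit_mx U /\ T X = g *: U) -> preserver T.
Proof.
move=> lT [S TK SK] h; split=> // [X TX|Y|X /h [g [U [U1 ->]]]|X /h [g [U [U1 ->]]]].
- by rewrite -[X]TK TX -[in LHS](rlin0 lT) TK.
- by exists (S Y).
- exists (re (cj g * g)); rewrite ctZ -scalemxAl -scalemxAr U1 scalerA.
  by rewrite -normE scalemx1.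
- exists (re (cj g * g)); rewrite ctZ -scalemxAl -scalemxAr (unit_mxC U1) scalerA.
  by rewrite -normE scalemx1 mulrC.
Qed.

Lemma standard_preserver n (T tau : 'M[F]_n -> 'M[F]_n) U V r :
  involutive tau -> (forall Y, unit_mx Y -> unit_mx (tau Y)) ->
  unit_mx U -> unit_mx V -> 0 < r ->
  (forall X, T X = inj r *: (U *m tau X *m V)) ->
  bijective T /\ forall X, unit_mx X -> exists g W, unit_mx W /\ T X = g *: W.
Proof.
move=> tauK utau U1 V1 r0 hT; split; last first.
  move=> X /utau X1; exists (inj r), (U *m tau X *m V); split; last exact: hT.
  by apply: unit_mxM => //; apply: unit_mxM.
have rr : inj r != 0 :> F by rewrite inj_eq0 gt_eqF.
exists (fun Y => tau ((inj r)^-1 *: (U^h *m Y *m V^h))) => X.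
  rewrite hT -scalemxAr -scalemxAl scalerA mulVf // scale1r !mulmxA U1 mul1mx.
  by rewrite -mulmxA (unit_mxC V1) mulmx1 tauK.
rewrite hT tauK -scalemxAr -scalemxAl scalerA divff // scale1r !mulmxA (unit_mxC U1).
by rewrite mul1mx -mulmxA V1 mulmx1.
Qed.

Lemma standard_form_preserver n (T : 'M[F]_n -> 'M[F]_n) : standard_form T ->
  bijective T /\ forall X, unit_mx X -> exists g W, unit_mx W /\ T X = g *: W.
Proof.
case=> U [V [r [U1 V1 r0 [] hT]]].
- by apply: (standard_preserver (tau := id)) hT.
- apply: (standard_preserver (tau := trmx)) hT => //; first exact: trmxK.
  exact: unit_mx_tr.
- apply: (standard_preserver (tau := map_mx cj)) hT => //; first exact: map_cjK.
  exact: unit_mx_map.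
- apply: (standard_preserver (tau := @ct R F n n)) hT => //; first exact: ctK.
  exact: unit_mx_ct.
Qed.

End Equivalence.

(** * The fields of real and complex numbers *)

Section Instances.
Variable R : realType.

(** [dim] is 0 because coordinates are indexed by ['I_dim.+1]. *)
Definition real_star : starField R.
Proof.
apply: (@StarField R R idfun idfun 0 (fun _ x => x) (fun _ => 1)) => //=.
- by move=> x; rewrite big_ord1 mulr1.
- by move=> c k; rewrite big_ord1 mulr1 [k]ord1.
- by move=> x x0 /=; rewrite -expr2 exprn_even_gt0.
- move=> f lf; exists (f 1) => x.
  have f0 : f 0 = 0.
    have := lf (-1) 0 0; rewrite mulr0 addr0 mulN1r => /eqP.
    by rewrite addNr => /eqP.
  by have := lf x 1 0; rewrite f0 !addr0 mulr1 => ->; rewrite mulrC.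
- by move=> f _ _ hf; left.
Defined.

Definition complex_star : starField R.
Proof.
apply: (@StarField R R[i] (real_complex R) (@conjc R) 1
  (fun k x => if k == ord0 then complex.Re x else complex.Im x)
  (fun k => if k == ord0 then 1 else 'i%C)) => /=.
- exact: conjcK.
- exact: conjc_real.
- by move=> k a [x1 x2] [y1 y2] /=; case: (k == ord0) => /=; ring.
- case=> a b; rewrite big_ord_recl big_ord1 /=; apply/eqP; rewrite eq_complex /=.
  by apply/andP; split; apply/eqP; ring.
- move=> c k; rewrite big_ord_recl big_ord1 /=.
  case: (unliftP ord0 k) => [j|] -> /=; last by ring.
  by rewrite [j]ord1; ring.
- by case.
- move=> [a b]; rewrite eq_complex /= => ab.
  have -> : a * a - - b * b = a ^+ 2 + b ^+ 2 by ring.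
  rewrite lt_def addr_ge0 ?sqr_ge0 // andbT paddr_eq0 ?sqr_ge0 //.
  by rewrite !sqrf_eq0.
- move=> [a b] [] /eqP; rewrite eq_sym -subr_eq0 opprK -mulr2n mulrn_eq0 /= => /eqP ->.
  by [].
(* The real part of [(f 1 - i f(i)) (x + i y)] is [x f(1) + y f(i)]. *)
- move=> f lf; exists (Complex (f 1) (- f 'i%C)) => -[x y].
  have f0 : f 0 = 0.
    have := lf (-1) 0 0; rewrite mulr0 addr0 mulN1r => /eqP.
    by rewrite addNr => /eqP.
  have -> : Complex x y = x%:C%C * 1 + (y%:C%C * 'i%C + 0).
    by apply/eqP; rewrite eq_complex /=; apply/andP; split; apply/eqP; ring.
  by rewrite lf lf f0 /=; ring.
- move=> f fD fM fR.
  have fE x y : f (Complex x y) = x%:C%C + y%:C%C * f 'i%C.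
    rewrite -[X in X + _](fR x) -[X in _ + X * _](fR y) -fM -fD; congr f.
    by apply/eqP; rewrite eq_complex /=; apply/andP; split; apply/eqP; ring.
  (* The image of [i] squares to -1, so it is [i] or [-i]. *)
  have : (f 'i%C - 'i%C) * (f 'i%C + 'i%C) = 0.
    have ii : 'i%C * 'i%C = (-1)%:C%C :> R[i].
      by apply/eqP; rewrite eq_complex /=; apply/andP; split; apply/eqP; ring.
    transitivity (f 'i%C * f 'i%C - 'i%C * 'i%C); first by ring.
    by rewrite -fM ii fR subrr.
  move/eqP; rewrite mulf_eq0 subr_eq0 addr_eq0 => /orP[]/eqP fi; [left|right].
    move=> [x y]; rewrite fE fi.
    by apply/eqP; rewrite eq_complex /=; apply/andP; split; apply/eqP; ring.
  move=> [x y]; rewrite fE fi.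
  by apply/eqP; rewrite eq_complex /=; apply/andP; split; apply/eqP; ring.
Defined.
End Instances.

(** * The theorem over the real and the complex numbers *)

Section Main.
Variables (R : realType) (n : nat).

Lemma orthogonal_unit (X : 'M[R]_n) : orthogonal_mx X <-> unit_mx (F := real_star R) X.
Proof. by rewrite /unit_mx /ct /orthogonal_mx map_mx_id. Qed.
End Main.

Theorem mainTheorem1 (R : realType) (n : nat) (hn : (3 <= n)%N) :
  (forall T : 'M[R]_n -> 'M[R]_n, real_linear_R T ->
     ((bijective T /\ preserves_scaled_orth T) <-> std_form_R T)) /\
  (forall T : 'M[R[i]]_n -> 'M[R[i]]_n, real_linear_C T ->
     ((bijective T /\ preserves_scaled_unitary T) <-> std_form_C T) /\
     (complex_linear T -> bijective T -> preserves_scaled_unitary T ->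
        std_form_C_lin T)).
Proof.
case: n hn => [|[|[|n]]] // _; split.
  move=> T lT; split=> [[bT pT]|].
    have gT : preserver (F := real_star R) T.
      apply: preserver_of_bijective => // X /orthogonal_unit /pT [g [U [U1 e]]].
      move/orthogonal_unit in U1; by exists g, U.
    have [U [V [r [U1 V1 r0 h]]]] := preserver_standard gT.
    move/orthogonal_unit in U1; move/orthogonal_unit in V1.
    (* Conjugation is trivial here, so the four forms collapse to two. *)
    exists U, V, r; split=> //; case: h => h; [left|right|left|right] => X; rewrite h //.
      by rewrite map_mx_id.
    by rewrite map_mx_id.
  move=> [U [V [r [/orthogonal_unit U1 /orthogonal_unit V1 r0 h]]]].
  have [|bT pT] := @standard_form_preserver _ (real_star R) _ T.
    by exists U, V, r; split=> //; case: h => h; [constructor 1|constructor 2].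
  split=> // X /orthogonal_unit /pT [g [W [/orthogonal_unit W1 e]]].
  by exists g, W.
move=> T lT.
have eqv : bijective T /\ preserves_scaled_unitary T <-> std_form_C T.
  split=> [[bT pT]|h]; last exact: (@standard_form_preserver _ (complex_star R) _ T).
  have gT : preserver (F := complex_star R) T by apply: preserver_of_bijective.
  have [U [V [r [U1 V1 r0 h]]]] := preserver_standard gT.
  by exists U, V, r; split.
split=> // cT bT pT; have /eqv [U [V [r [U1 V1 r0 h]]]] := conj bT pT.
(* In the two conjugate forms [T (i X) = - i T X], while complex linearity gives [i T X]; applied to
   the identity matrix, this contradicts injectivity. *)
have nz X : 'i%C *: T X = - 'i%C *: T X -> X = 0.
  move=> /eqP; rewrite -subr_eq0 -scalerBl opprK -mulr2n scaler_eq0 mulrn_eq0 /=.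
  rewrite eq_complex /= oner_eq0 andbF /= => /eqP TX.
  have T0 : T 0 = 0 by have := cT (-1) 0 0; rewrite scaler0 addr0 scaleN1r addNr.
  by apply: (bij_inj bT); rewrite TX T0.
have cTZ X : T ('i%C *: X) = 'i%C *: T X.
  have T0 : T 0 = 0 by have := cT (-1) 0 0; rewrite scaler0 addr0 scaleN1r addNr.
  by have := cT 'i%C X 0; rewrite T0 !addr0.
have one0 : (1%:M : 'M[R[i]]_n.+3) <> 0.
  by move=> /matrixP/(_ 0 0)/eqP; rewrite !mxE eqxx oner_eq0.
have conji X : conj_mx ('i%C *: X) = - 'i%C *: conj_mx X :> 'M[R[i]]_n.+3.
  rewrite /conj_mx map_mxZ; congr (_ *: _).
  by apply/eqP; rewrite eq_complex /= oppr0 !eqxx.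
exists U, V, r; split=> //; case: h => h; [by left|by right|exfalso..]; apply/one0/nz.
  rewrite -cTZ !h conji -scalemxAr -scalemxAl.
  by rewrite scalerA mulrC -scalerA.
rewrite -cTZ !h conji linearZ /= -scalemxAr -scalemxAl.
by rewrite scalerA mulrC -scalerA.
Qed.
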